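(* $\mathrm{DIM}^1_{\mathrm{str}}=\{A\in\mathbf C:{\mathrm{Dim}}(A)=1\}$ is not a $\Pi^0_2$-class. Hence it is properly $\Pi^0_2[\Pi^0_1]$, i.e. it is in $\Pi^0_2[\Pi^0_1]$ but not in $\Pi^0_2$.
   Context: $\mathbf{C}=\{0,1\}^{\mathbb N}$; $A\upharpoonright n$ is the first $n$ bits of $A$. ${\mathrm{Dim}}(A)$ is the constructive strong dimension: the infimum of $s$ such that some lower semicomputable $s$-gale $d$ (i.e. $d:\{0,1\}^*\to[0,\infty)$ with $2^sd(w)=d(w0)+d(w1)$) satisfies $\liminf_n d(A\upharpoonright n)=\infty$; equivalently ${\mathrm{Dim}}(A)=\limsup_n K(A\upharpoonright n)/n$, $K$ prefix-free Kolmogorov complexity. $\mathcal X\in\Pi^0_2$ iff for some decidable predicate $R$, $A\in\mathcal X\iff(\forall k)(\exists m)R(k,A\upharpoonright m)$; $\mathcal X\in\Pi^0_2[\Pi^0_1]$ iff the same holds with $R$ a co-c.e. predicate. *)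

(* Defs.v *)
(* Built on MathComp-Analysis; the reals are an arbitrary [R : realType]. *)
From mathcomp Require Import all_boot all_order all_algebra.
From mathcomp Require Import boolp classical_sets reals ereal sequences exp.
Set Implicit Arguments.
Unset Strict Implicit.
Unset Printing Implicit Defensive.
Import Order.TTheory GRing.Theory Num.Theory.
Local Open Scope classical_set_scope.

(* Kleene's mu-recursive functions.  Arities are not tracked: arguments are
   given as a list, missing arguments read as 0 and superfluous ones are
   ignored, which does not change the class of k-ary partial recursive
   functions for any k. *)
Inductive recfun : Type :=
| Zero
| Succ
| Proj of nat
| Comp of recfun & seq recfun
| Prec of recfun & recfun
| Mu of recfun.

(* [evalsto f xs y]: the partial function [f] is defined at [xs], with value
   [y].  In [Prec] the recursion argument comes first, and [h] lists the
   successive values of the recursion.  [Mu f] is the least root of [f] in its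
   first argument, all earlier values being defined and nonzero. *)
Fixpoint evalsto (f : recfun) (xs : seq nat) (y : nat) {struct f} : Prop :=
  match f with
  | Zero => y = 0%N
  | Succ => y = (head 0%N xs).+1
  | Proj i => y = nth 0%N xs i
  | Comp g hs =>
      exists zs : seq nat,
        (fix evalall (l : seq recfun) (v : seq nat) {struct l} : Prop :=
           match l, v with
           | [::], [::] => True
           | h :: l', z :: v' => evalsto h xs z /\ evalall l' v'
           | _, _ => False
           end) hs zs
        /\ evalsto g zs y
  | Prec g s =>
      exists h : nat -> nat,
        [/\ evalsto g (behead xs) (h 0%N),
            forall i : nat, (i < head 0 xs)%N ->
              evalsto s [:: i, h i & behead xs] (h i.+1)
          & y = h (head 0%N xs)]
  | Mu g =>
      evalsto g (y :: xs) 0%N /\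
      (forall i : nat, (i < y)%N -> exists z : nat, evalsto g (i :: xs) z.+1)
  end.

Definition halts (f : recfun) (xs : seq nat) : Prop :=
  exists y : nat, evalsto f xs y.

(* The bijective base-2 numbering of binary strings. *)
Fixpoint code (w : seq bool) : nat :=
  if w is b :: w' then ((code w').*2 + b).+1 else 0%N.

Definition decidable_pred (P : nat -> seq bool -> Prop) : Prop :=
  exists f : recfun, forall (k : nat) (w : seq bool),
    (P k w -> evalsto f [:: k; code w] 1%N) /\
    (~ P k w -> evalsto f [:: k; code w] 0%N).

Definition ce_pred (P : nat -> seq bool -> Prop) : Prop :=
  exists f : recfun, forall (k : nat) (w : seq bool),
    P k w <-> halts f [:: k; code w].

Definition co_ce_pred (P : nat -> seq bool -> Prop) : Prop :=
  ce_pred (fun k w => ~ P k w).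

(* [mkseq A n] is the string of the first [n] bits of [A : nat -> bool]. *)
Definition Pi2_over (C : (nat -> seq bool -> Prop) -> Prop)
    (X : set (nat -> bool)) : Prop :=
  exists P : nat -> seq bool -> Prop,
    C P /\
    forall A : nat -> bool, X A <-> forall k, exists m, P k (mkseq A m).

Definition Pi02 : set (nat -> bool) -> Prop := Pi2_over decidable_pred.

Definition Pi02_Pi01 : set (nat -> bool) -> Prop := Pi2_over co_ce_pred.

Local Open Scope ring_scope.

Definition gale (R : realType) (s : R) (d : seq bool -> R) : Prop :=
  (forall w, 0 <= d w) /\
  (forall w, 2 `^ s * d w = d (rcons w false) + d (rcons w true)).

(* The set of pairs (w, q) with q rational and q < d w is c.e.  Only q >= 0,
   written a / (b + 1), is considered: for a nonnegative d every negative q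
   is below d w. *)
Definition lower_semicomputable (R : realType) (d : seq bool -> R) : Prop :=
  exists f : recfun, forall (w : seq bool) (a b : nat),
    a%:R / b.+1%:R < d w <-> halts f [:: code w; a; b].

Definition succeeds_strongly (R : realType) (d : seq bool -> R)
    (A : nat -> bool) : Prop :=
  limn_einf (fun n => (d (mkseq A n))%:E) = +oo%E.

(* The set below contains every rational s > 1 and no s <= 0, so that its
   real-valued [inf] is a genuine infimum. *)
Definition Dim (R : realType) (A : nat -> bool) : R :=
  inf [set s : R | exists d : seq bool -> R,
         [/\ gale s d, lower_semicomputable d & succeeds_strongly d A]].

Definition DIM1str (R : realType) : set (nat -> bool) :=
  [set A | Dim R A = 1].

(* Main.v *)
Require Import Defs.
From mathcomp Require Import all_boot all_order all_algebra.
From mathcomp Require Import boolp classical_sets reals ereal sequences exp.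
From mathcomp Require Import topology normedtype.
From mathcomp Require Import zify ring lra.
(* Last, so that [code] is not shadowed. *)
Require Import Defs.

Set Implicit Arguments.
Unset Strict Implicit.
Unset Printing Implicit Defensive.
Import Order.TTheory GRing.Theory Num.Theory numFieldNormedType.Exports.

(** Lower semicomputable gales with growth factor below 2 are replaced by tests:
    fix a program [e] and [m], and accept, of the strings of each length [n]
    enumerated by [e], only the first ((2 m + 1) / (m + 2)) ^ n.  An s-gale with
    s < 1 exceeds 1 on at most 2 ^ (s n) d(empty) strings of length n, so for some
    [e] and [m] these are accepted for almost all n; conversely a weighted sum of
    the gales betting on the accepted strings is a single lower semicomputable
    gale of growth below 2 that is unbounded along every sequence almost all of
    whose prefixes are accepted.  Hence Dim A = 1 iff for all [e], [m], [n0] some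
    prefix of A of length at least [n0] is not accepted.  Acceptance is uniformly
    c.e. by Kleene's normal form theorem, which gives the upper bound.

    For the lower bound, following the smaller successor of that gale shows that
    every string extends to a rejected one, so the sequences of strong dimension 1
    are dense.  A dense class of the form "for all k, some prefix satisfies P k"
    with P decidable contains a computable sequence (effective Baire category),
    and a computable sequence has strong dimension below 1. *)

(** * Recursive functions *)

(** A named copy of the anonymous fixpoint inside [evalsto]; being convertible to it, it makes
    [evalsto_Comp] hold by computation. *)
Definition evalall (xs : seq nat) : seq recfun -> seq nat -> Prop :=
  fix evalall (l : seq recfun) (v : seq nat) {struct l} : Prop :=
    match l, v with
    | [::], [::] => True
    | h :: l', z :: v' => evalsto h xs z /\ evalall l' v'
    | _, _ => False
    end.

Lemma evalsto_Comp g hs xs y :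
  evalsto (Comp g hs) xs y <->
  exists zs, evalall xs hs zs /\ evalsto g zs y.
Proof. by []. Qed.

(** The automatic principle gives no hypothesis for the programs listed inside [Comp]; here they get
    one, as an iterated conjunction. *)
Fixpoint recfun_nested_ind (P : recfun -> Prop)
  (PZ : P Zero) (PS : P Succ) (PP : forall i, P (Proj i))
  (PC : forall g hs, P g -> foldr (fun h => and (P h)) True hs -> P (Comp g hs))
  (PR : forall g s, P g -> P s -> P (Prec g s))
  (PM : forall g, P g -> P (Mu g)) (f : recfun) {struct f} : P f :=
  let rec := recfun_nested_ind PZ PS PP PC PR PM in
  match f return P f with
  | Zero => PZ
  | Succ => PS
  | Proj i => PP i
  | Comp g hs => PC g hs (rec g)
      ((fix all (l : seq recfun) : foldr (fun h => and (P h)) True l :=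
         if l is h :: l' then conj (rec h) (all l') else I) hs)
  | Prec g s => PR g s (rec g) (rec s)
  | Mu g => PM g (rec g)
  end.

Lemma evalsto_inj f xs y z : evalsto f xs y -> evalsto f xs z -> y = z.
Proof.
elim/recfun_nested_ind: f xs y z => [||i|g hs IHg IHhs|g s IHg IHs|g IHg] xs y z.
- by move=> /= -> ->.
- by move=> /= -> ->.
- by move=> /= -> ->.
- move=> /evalsto_Comp [us [hu gu]] /evalsto_Comp [vs [hv gv]].
  suff e : us = vs by subst vs; exact: IHg gu gv.
  elim: hs IHhs us vs hu hv {gu gv} => [|h hs IH] /= IHhs [|u us] [|v vs] //.
  by case: IHhs => Ph Phs [eu aus] [ev avs]; rewrite (Ph _ _ _ eu ev) (IH Phs us vs).
- move=> /= [h [h0 hS ->]] [h' [h0' hS' ->]].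
  have : forall i, i <= head 0 xs -> h i = h' i.
    elim=> [_|i IH lt_i]; first exact: IHg h0 h0'.
    have e := IH (ltnW lt_i).
    by apply: (IHs _ _ _ (hS i lt_i)); rewrite e; exact: hS'.
  by apply.
- move=> /= [gy ly] [gz lz].
  (* If the roots differ, [g] takes both the value 0 and a successor at the smaller one. *)
  case: (ltngtP y z) => // lt.
    by have [w gw] := lz _ lt; have := IHg _ _ _ gy gw.
  by have [w gw] := ly _ lt; have := IHg _ _ _ gz gw.
Qed.

(** * Total computable functions and their closure properties *)

Definition computable (k : nat) (F : seq nat -> nat) : Prop :=
  exists f, forall xs, size xs = k -> evalsto f xs (F xs).

Lemma computable_ext_in k F G :
  (forall xs, size xs = k -> F xs = G xs) -> computable k F -> computable k G.
Proof. by move=> e [f fP]; exists f => xs xk; rewrite -e //; exact: fP. Qed.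

Lemma computable_ext k F G : (forall xs, F xs = G xs) -> computable k F -> computable k G.
Proof. by move=> e; apply: computable_ext_in => xs _; exact: e. Qed.

Lemma computable_proj k i : computable k (fun xs => nth 0 xs i).
Proof. by exists (Proj i). Qed.

Lemma computable_comp k G (Hs : seq (seq nat -> nat)) :
  computable (size Hs) G -> foldr (fun H => and (computable k H)) True Hs ->
  computable k (fun xs => G [seq H xs | H <- Hs]).
Proof.
move=> [g gP] HP.
have [hs hsP] : exists hs, forall xs, size xs = k ->
    evalall xs hs [seq H xs | H <- Hs].
  elim: Hs HP {gP} => [_|H Hs IH [[h hP] /IH [hs hsP]]]; first by exists [::].
  by exists (h :: hs) => xs xk /=; split; [exact: hP|exact: hsP].
exists (Comp g hs) => xs xk; apply/evalsto_Comp.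
by exists [seq H xs | H <- Hs]; split; [exact: hsP | apply: gP; rewrite size_map].
Qed.

Lemma computable_comp1 k (g : nat -> nat) A :
  computable 1 (fun xs => g (nth 0 xs 0)) -> computable k A ->
    computable k (fun xs => g (A xs)).
Proof. by move=> gP AP; apply: (@computable_comp k _ [:: A] gP). Qed.

Lemma computable_comp2 k (g : nat -> nat -> nat) A B :
  computable 2 (fun xs => g (nth 0 xs 0) (nth 0 xs 1)) ->
  computable k A -> computable k B -> computable k (fun xs => g (A xs) (B xs)).
Proof. by move=> gP AP BP; apply: (@computable_comp k _ [:: A; B] gP). Qed.

Lemma computable_comp3 k (g : nat -> nat -> nat -> nat) A B C :
  computable 3 (fun xs => g (nth 0 xs 0) (nth 0 xs 1) (nth 0 xs 2)) ->
  computable k A -> computable k B -> computable k C ->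
    computable k (fun xs => g (A xs) (B xs) (C xs)).
Proof. by move=> gP AP BP CP; apply: (@computable_comp k _ [:: A; B; C] gP). Qed.

Lemma computable_comp4 k (g : nat -> nat -> nat -> nat -> nat) A B C D :
  computable 4 (fun xs => g (nth 0 xs 0) (nth 0 xs 1) (nth 0 xs 2) (nth 0 xs 3)) ->
  computable k A -> computable k B -> computable k C -> computable k D ->
  computable k (fun xs => g (A xs) (B xs) (C xs) (D xs)).
Proof. by move=> gP AP BP CP DP; apply: (@computable_comp k _ [:: A; B; C; D] gP). Qed.

Lemma computable_zero k : computable k (fun=> 0).
Proof. by exists Zero. Qed.

Lemma computable_succ k A : computable k A -> computable k (fun xs => (A xs).+1).
Proof.
apply: (@computable_comp1 k S); exists Succ => xs _ /=.
by rewrite nth0.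
Qed.

Lemma computable_const k c : computable k (fun=> c).
Proof. by elim: c => [|c IH]; [exact: computable_zero | exact: computable_succ]. Qed.

Lemma evalall_projs xs : evalall xs [seq Proj i | i <- iota 0 (size xs)] xs.
Proof.
suff H : forall m ys, (forall i, nth 0 ys i = nth 0 xs (m + i)) ->
    evalall xs [seq Proj i | i <- iota m (size ys)] ys by exact: H.
move=> m ys; elim: ys m => [|y ys IH] m //= H; split.
  by have := H 0; rewrite addn0 /= => ->.
by apply: IH => i; have := H i.+1; rewrite addnS addSn.
Qed.

(** [Prec] recurses on its first argument, so the program puts [N xs] in front of copies of all
    arguments; the copying needs a known arity [k]. *)
Lemma computable_rec k G (S : nat -> nat -> seq nat -> nat) N :
  computable k G -> computable k.+2 (fun ys => S (nth 0 ys 0) (nth 0 ys 1) (behead (behead ys))) ->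
  computable k N ->
  computable k (fun xs => nat_rect (fun=> nat) (G xs) (fun i h => S i h xs) (N xs)).
Proof.
move=> [g gP] [s sP] [n nP].
exists (Comp (Prec g s) (n :: [seq Proj i | i <- iota 0 k])) => xs xk.
apply/evalsto_Comp; exists (N xs :: xs); split.
  by split; [exact: nP | have := evalall_projs xs; rewrite xk].
exists (nat_rect (fun=> nat) (G xs) (fun i h => S i h xs)); split => //=.
  exact: gP.
move=> i _; set h := nat_rect _ _ _ _.
by have := sP [:: i, h & xs]; apply; rewrite /= xk.
Qed.

Lemma computable_pred k A : computable k A -> computable k (fun xs => (A xs).-1).
Proof.
move=> AP; apply: (computable_ext (F := fun xs => nat_rect _ 0 (fun i h => i) (A xs))).
  by move=> xs; case: (A xs).
by apply: computable_rec => //; [exact: computable_zero | exact: computable_proj].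
Qed.

Lemma computable_add k A B : computable k A -> computable k B ->
  computable k (fun xs => A xs + B xs).
Proof.
move=> AP BP; apply: (computable_ext (F := fun xs => nat_rect _ (A xs) (fun i h => h.+1) (B xs))).
  by move=> xs; elim: (B xs) => [|n /= ->]; rewrite ?addn0 ?addnS.
by apply: computable_rec => //; apply: computable_succ; exact: computable_proj.
Qed.

Lemma computable_sub k A B : computable k A -> computable k B ->
  computable k (fun xs => A xs - B xs).
Proof.
move=> AP BP; apply: (computable_ext (F := fun xs => nat_rect _ (A xs) (fun i h => h.-1) (B xs))).
  by move=> xs; elim: (B xs) => [|n /= ->]; rewrite ?subn0 ?subnS.
by apply: computable_rec => //; apply: computable_pred; exact: computable_proj.
Qed.


Lemma computable_mul k A B : computable k A -> computable k B ->
  computable k (fun xs => A xs * B xs).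
Proof.
move=> AP BP; apply: (computable_comp2 (g := muln)) => //.
apply: (computable_ext (F := fun xs =>
  nat_rect _ 0 (fun i h => h + nth 0 xs 0) (nth 0 xs 1))) => [xs|].
  by elim: (nth 0 xs 1) => [|n /= ->]; rewrite ?muln0 // mulnS addnC.
apply: (computable_rec (S := fun i h xs => h + nth 0 xs 0));
  try exact: computable_const; try exact: computable_proj.
apply: computable_add; first exact: computable_proj.
by exists (Proj 2) => xs _; rewrite /= !nth_behead.
Qed.

Lemma computable_exp k A B : computable k A -> computable k B ->
  computable k (fun xs => A xs ^ B xs).
Proof.
move=> AP BP; apply: (computable_comp2 (g := expn)) => //.
apply: (computable_ext (F := fun xs =>
  nat_rect _ 1 (fun i h => h * nth 0 xs 0) (nth 0 xs 1))) => [xs|].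
  by elim: (nth 0 xs 1) => [|n /= ->]; rewrite ?expn0 // expnS mulnC.
apply: (computable_rec (S := fun i h xs => h * nth 0 xs 0));
  try exact: computable_const; try exact: computable_proj.
apply: computable_mul; first exact: computable_proj.
by exists (Proj 2) => xs _; rewrite /= !nth_behead.
Qed.

Lemma computable_leq k A B : computable k A -> computable k B ->
  computable k (fun xs => A xs <= B xs).
Proof.
move=> AP BP; apply: (computable_ext (F := fun xs => 1 - (A xs - B xs))) => [xs|].
  by rewrite -subn_eq0; case: (A xs - B xs).
by apply: computable_sub; [exact: computable_const | exact: computable_sub].
Qed.

Lemma computable_neg k (A : seq nat -> bool) : computable k (fun xs => A xs) ->
  computable k (fun xs => ~~ A xs).
Proof.
move=> AP; apply: (computable_ext (F := fun xs => 1 - A xs)) => [xs|];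
  first by case: (A xs).
by apply: computable_sub => //; exact: computable_const.
Qed.

Lemma computable_and k (A B : seq nat -> bool) : computable k (fun xs => A xs) ->
  computable k (fun xs => B xs) -> computable k (fun xs => A xs && B xs).
Proof.
move=> AP BP; apply: (computable_ext (F := fun xs => A xs * B xs)) => [xs|].
  by rewrite mulnb.
exact: computable_mul.
Qed.

Lemma computable_or k (A B : seq nat -> bool) : computable k (fun xs => A xs) ->
  computable k (fun xs => B xs) -> computable k (fun xs => A xs || B xs).
Proof.
move=> AP BP; apply: (computable_ext (F := fun xs => ~~ (~~ A xs && ~~ B xs))) => [xs|].
  by rewrite -negb_or negbK.
by apply: computable_neg; apply: computable_and; exact: computable_neg.
Qed.

Lemma computable_eq k A B : computable k A -> computable k B ->
  computable k (fun xs => A xs == B xs).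
Proof.
move=> AP BP; apply: (computable_ext (F := fun xs => (A xs <= B xs) && (B xs <= A xs))) => [xs|].
  by rewrite eqn_leq.
by apply: computable_and; exact: computable_leq.
Qed.

Lemma computable_if k (C : seq nat -> bool) A B : computable k (fun xs => C xs) ->
  computable k A -> computable k B -> computable k (fun xs => if C xs then A xs else B xs).
Proof.
move=> CP AP BP; apply: (computable_ext (F := fun xs => C xs * A xs + ~~ C xs * B xs)) => [xs|].
  by case: (C xs); rewrite ?mul1n ?mul0n ?addn0.
by apply: computable_add; apply: computable_mul => //; exact: computable_neg.
Qed.


Lemma computable_reindex k F (l : seq nat) :
  computable (size l) F -> computable k (fun ys => F [seq nth 0 ys i | i <- l]).
Proof.
move=> FP; have := @computable_comp k F [seq (fun ys => nth 0 ys i) | i <- l].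
rewrite size_map => /(_ FP) H; apply: (computable_ext _ (H _)) => [ys|].
  by rewrite -map_comp.
by elim: l {FP H} => //= i l IH; split => //; exact: computable_proj.
Qed.

(* The bound variable is kept in [nat] so that unification can abstract it. *)
Definition nsum (n : nat) (F : nat -> nat) : nat := \sum_(i < n) F i.

Lemma computable_sum k (F : nat -> seq nat -> nat) N :
  computable k.+1 (fun ys => F (nth 0 ys 0) (behead ys)) -> computable k N ->
  computable k (fun xs => nsum (N xs) (fun i => F i xs)).
Proof.
move=> FP NP; apply: (computable_ext (F := fun xs =>
  nat_rect _ 0 (fun i h => h + F i xs) (N xs))) => [xs|].
  by rewrite /nsum; elim: (N xs) => [|n /= ->]; rewrite ?big_ord0 // big_ord_recr.
apply: (computable_rec (S := fun i h xs => h + F i xs)) => //;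
  first exact: computable_const.
apply: computable_add; first exact: computable_proj.
have := @computable_reindex k.+2 _ (0 :: iota 2 k); rewrite /= size_iota => /(_ _ FP).
apply: computable_ext_in => -[|a [|b ys]] //= [<-]; congr F.
by apply: (@eq_from_nth _ 0); rewrite size_map size_iota // => i ilt;
  rewrite (nth_map 0) ?size_iota // nth_iota.
Qed.

(* Bounded quantifiers, in a form that the computability tactic recognises. *)
Definition bex (n : nat) (b : nat -> bool) : bool := 0 < nsum n b.
Definition ball (n : nat) (b : nat -> bool) : bool := ~~ bex n (fun i => ~~ b i).

Lemma bexP n (b : nat -> bool) : reflect (exists2 i, i < n & b i) (bex n b).
Proof.
rewrite /bex /nsum lt0n sum_nat_eq0; apply: (iffP idP) => [/forallPn [i]|[i ilt bi]].
  by rewrite /= eqb0 negbK => bi; exists i.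
by apply/forallPn; exists (Ordinal ilt); rewrite /= eqb0 negbK.
Qed.

Lemma ballP n (b : nat -> bool) : reflect (forall i, i < n -> b i) (ball n b).
Proof.
apply: (iffP negP) => [H i ilt|H /bexP [i /H ->]] //.
by apply/negPn/negP => nb; apply: H; apply/bexP; exists i.
Qed.

Lemma computable_bex k (b : nat -> seq nat -> bool) N :
  computable k.+1 (fun ys => b (nth 0 ys 0) (behead ys)) -> computable k N ->
  computable k (fun xs => bex (N xs) (fun i => b i xs)).
Proof.
move=> bP NP; apply: computable_leq; first exact: computable_const.
exact: (computable_sum (F := fun i xs => b i xs)).
Qed.

Lemma computable_ball k (b : nat -> seq nat -> bool) N :
  computable k.+1 (fun ys => b (nth 0 ys 0) (behead ys)) -> computable k N ->
  computable k (fun xs => ball (N xs) (fun i => b i xs)).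
Proof.
move=> bP NP; apply: computable_neg.
by apply: (computable_bex (b := fun i xs => ~~ b i xs)) => //; exact: computable_neg.
Qed.

(** Unbounded search. [Mu] looks for a root, hence the negation; as [b] is total, all values before
    the first root are defined. *)
Lemma computable_mu k (b : nat -> seq nat -> bool) :
  computable k.+1 (fun ys => b (nth 0 ys 0) (behead ys)) ->
  exists f, forall xs, size xs = k ->
    (forall y, evalsto f xs y -> b y xs) /\ ((exists y, b y xs) -> halts f xs).
Proof.
move=> /computable_neg [g gP]; exists (Mu g) => xs xk.
have gE y : evalsto g (y :: xs) (~~ b y xs) by apply: gP; rewrite /= xk.
split=> [y [gy _]|exb].
  by have := evalsto_inj (gE y) gy; case: (b y xs).
case: (ex_minnP exb) => y by_ ymin; exists y; split.
  by have := gE y; rewrite by_.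
move=> i ilt; exists 0; have := gE i; case bi: (b i xs) => //.
by have := ymin i bi; rewrite leqNgt ilt.
Qed.

(** When a witness always exists, the search is total and its result is a computable choice
    function. *)
Lemma computable_choice k (b : nat -> seq nat -> bool) :
  computable k.+1 (fun ys => b (nth 0 ys 0) (behead ys)) ->
  (forall xs, size xs = k -> exists y, b y xs) ->
  exists2 G, computable k G & forall xs, size xs = k -> b (G xs) xs.
Proof.
move=> /computable_mu [f fP] exb.
have {}fP xs : exists y, size xs = k -> evalsto f xs y /\ b y xs.
  have [xk|] := eqVneq (size xs) k; last by move=> /eqP xk; exists 0.
  have [bf hf] := fP xs xk; have [y fy] := hf (exb xs xk).
  by exists y => _; split => //; exact: bf.
have [G GP] := choice fP; exists G; last by move=> xs /GP [].
by exists f => xs /GP [].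
Qed.

(** Projections of decidable relations are c.e.; this supplies the programs for lower
    semicomputability and for the co-c.e. predicate. *)
Lemma halts_bool k (b : nat -> seq nat -> bool) :
  computable k.+1 (fun ys => b (nth 0 ys 0) (behead ys)) ->
  exists f, forall xs, size xs = k -> halts f xs <-> exists y, b y xs.
Proof.
move=> /computable_mu [f fP]; exists f => xs /fP [bf hf]; split => //.
by case=> y /bf; exists y.
Qed.

Lemma computable_odd k A : computable k A -> computable k (fun xs => odd (A xs)).
Proof.
move=> AP; apply: (computable_ext (F := fun xs =>
  nat_rect _ 0 (fun i h => 1 - h) (A xs))) => [xs|].
  by elim: (A xs) => //= n ->; case: (odd n).
apply: (computable_rec (S := fun i h xs => 1 - h)) => //; first exact: computable_const.
by apply: computable_sub; [exact: computable_const | exact: computable_proj].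
Qed.

Lemma computable_div k A B : computable k A -> computable k B ->
  computable k (fun xs => A xs %/ B xs).
Proof.
move=> AP BP; apply: (computable_comp2 (g := divn)) => //.
(* The quotient is the number of positive multiples of the divisor up to the dividend; a zero
   divisor gives 0, as in [divn]. *)
apply: (computable_ext (F := fun xs => if 1 <= nth 0 xs 1 then
  nsum (nth 0 xs 0) (fun i => i.+1 * nth 0 xs 1 <= nth 0 xs 0) else 0)) => [xs|].
  move: (nth 0 xs 0) (nth 0 xs 1) => a b; case: (posnP b) => [->|b0].
    by rewrite divn0.
  have : forall n, \sum_(i < n) (i.+1 * b <= a) = minn n (a %/ b).
    elim=> [|n IH]; first by rewrite big_ord0 min0n.
    by rewrite big_ord_recr /= IH -leq_divRL //; case: leqP; lia.
  by rewrite /nsum => ->; apply/minn_idPr; exact: leq_div.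
apply: computable_if; try exact: computable_const.
  by apply: computable_leq; [exact: computable_const | exact: computable_proj].
apply: (computable_sum (F := fun i xs => i.+1 * nth 0 xs 1 <= nth 0 xs 0));
  last exact: computable_proj.
apply: computable_leq; last by exists (Proj 1) => xs _; rewrite /= !nth_behead.
apply: computable_mul; first by apply: computable_succ; exact: computable_proj.
by exists (Proj 2) => xs _; rewrite /= !nth_behead.
Qed.

(* A tactic for computability goals *)
Create HintDb computable.

Ltac computable_leaf :=
  let go n := (exists (Proj n); let ys := fresh in move=> ys _;
               rewrite /evalsto ?nth_behead; reflexivity) in
  first [go 0 | go 1 | go 2 | go 3 | go 4 | go 5 | go 6 | go 7 | go 8 | go 9].

(** Constants are tried first, then the heads with a closure lemma; any other head of at most four
    arguments is split off by composition and looked up in the hint database. *)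
Ltac computable_step :=
  cbv beta; first [refine (computable_const _ _) |
  lazymatch goal with
  | |- computable _ (fun xs => nth _ _ _) => computable_leaf
  | |- computable _ (fun xs => nat_of_bool (leq _ _)) => apply: computable_leq
  | |- computable _ (fun xs => nat_of_bool (andb _ _)) => apply: computable_and
  | |- computable _ (fun xs => nat_of_bool (orb _ _)) => apply: computable_or
  | |- computable _ (fun xs => nat_of_bool (negb _)) => apply: computable_neg
  | |- computable _ (fun xs => nat_of_bool (eq_op _ _)) => apply: computable_eq
  | |- computable _ (fun xs => nat_of_bool (bex _ _)) => apply: computable_bex
  | |- computable _ (fun xs => nat_of_bool (ball _ _)) => apply: computable_ball
  | |- computable _ (fun xs => nat_of_bool (odd _)) => apply: computable_odd
  | |- computable _ (fun xs => divn _ _) => apply: computable_div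
  | |- computable _ (fun xs => addn _ _) => apply: computable_add
  | |- computable _ (fun xs => muln _ _) => apply: computable_mul
  | |- computable _ (fun xs => subn _ _) => apply: computable_sub
  | |- computable _ (fun xs => expn _ _) => apply: computable_exp
  | |- computable _ (fun xs => predn _) => apply: computable_pred
  | |- computable _ (fun xs => S _) => apply: computable_succ
  | |- computable _ (fun xs => if _ then _ else _) => apply: computable_if
  | |- computable _ (fun xs => nsum _ _) => apply: computable_sum
  | |- computable _ (fun xs => nat_of_bool (?g (@?A xs) (@?B xs) (@?C xs) (@?D xs))) =>
      refine (computable_comp4 (g := fun a b c d => nat_of_bool (g a b c d)) _ _ _ _ _);
      [solve [auto with computable nocore] | ..]
  | |- computable _ (fun xs => nat_of_bool (?g (@?A xs) (@?B xs) (@?C xs))) =>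
      refine (computable_comp3 (g := fun a b c => nat_of_bool (g a b c)) _ _ _ _);
      [solve [auto with computable nocore] | ..]
  | |- computable _ (fun xs => nat_of_bool (?g (@?A xs) (@?B xs))) =>
      refine (computable_comp2 (g := fun a b => nat_of_bool (g a b)) _ _ _);
      [solve [auto with computable nocore] | ..]
  | |- computable _ (fun xs => nat_of_bool (?g (@?A xs))) =>
      refine (computable_comp1 (g := fun a => nat_of_bool (g a)) _ _);
      [solve [auto with computable nocore] | ..]
  | |- computable _ (fun xs => ?g (@?A xs) (@?B xs) (@?C xs) (@?D xs)) =>
      refine (computable_comp4 (g := g) _ _ _ _ _); [solve [auto with computable nocore] | ..]
  | |- computable _ (fun xs => ?g (@?A xs) (@?B xs) (@?C xs)) =>
      refine (computable_comp3 (g := g) _ _ _ _); [solve [auto with computable nocore] | ..]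
  | |- computable _ (fun xs => ?g (@?A xs) (@?B xs)) =>
      refine (computable_comp2 (g := g) _ _ _); [solve [auto with computable nocore] | ..]
  | |- computable _ (fun xs => ?g (@?A xs)) =>
      first [assumption |
      refine (computable_comp1 (g := g) _ _); [solve [auto with computable nocore] | ..]]
  | |- computable _ (fun xs => _) => assumption
  end].
Ltac computability := repeat computable_step.

(** * Kleene's normal form *)

(** An injective but not surjective pairing. By injectivity the sums in [pr1] and [pr2] have at most
    one nonzero term; on numbers that are not pairs they return 0. *)
Definition pr (a b : nat) : nat := (a + b) * (a + b) + a.
Definition pr1 (n : nat) : nat :=
  nsum n.+1 (fun a => nsum n.+1 (fun b => (pr a b == n) * a)).
Definition pr2 (n : nat) : nat :=
  nsum n.+1 (fun a => nsum n.+1 (fun b => (pr a b == n) * b)).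

(** Since [a <= a + b], the value lies below the next square, so it determines [a + b] and then
    [a]. *)
Lemma pr_inj a b a' b' : pr a b = pr a' b' -> a = a' /\ b = b'.
Proof. rewrite /pr => e; have : a + b = a' + b' by nia. by move=> s; nia. Qed.

Lemma pr_eq a b a' b' : (pr a b == pr a' b') = (a == a') && (b == b').
Proof.
by apply/eqP/andP => [/pr_inj [-> ->]|[/eqP -> /eqP ->]].
Qed.

Lemma leq_pr1 a b : a <= pr a b.
Proof. by rewrite /pr; nia. Qed.

Lemma leq_pr2 a b : b <= pr a b.
Proof. by rewrite /pr; nia. Qed.

Lemma nsum_delta n k (F : nat -> nat) :
  k < n -> nsum n (fun i => (i == k) * F i) = F k.
Proof.
move=> kn; rewrite /nsum (bigD1 (Ordinal kn)) //= eqxx mul1n big1 ?addn0 //.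
by move=> i; rewrite -val_eqE /= => /negbTE ->.
Qed.

Lemma eq_nsum n F G : (forall i, F i = G i) -> nsum n F = nsum n G.
Proof. by move=> e; apply: eq_bigr => i _. Qed.

Lemma pr1K a b : pr1 (pr a b) = a.
Proof.
rewrite /pr1 -[RHS](nsum_delta id (leq_pr1 a b : a < (pr a b).+1)).
apply: eq_nsum => i.
rewrite -[RHS](nsum_delta (fun=> (i == a) * i) (leq_pr2 a b : b < (pr a b).+1)).
by apply: eq_nsum => j; rewrite pr_eq mulnA mulnb andbC.
Qed.

Lemma pr2K a b : pr2 (pr a b) = b.
Proof.
rewrite /pr2 -[RHS](nsum_delta (fun=> b) (leq_pr1 a b : a < (pr a b).+1)).
apply: eq_nsum => i.
rewrite -[in RHS](nsum_delta (fun j => j) (leq_pr2 a b : b < (pr a b).+1)).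
rewrite /nsum big_distrr; apply: eq_bigr => j _.
by rewrite /= pr_eq -mulnb mulnA.
Qed.

Lemma computable_pr : computable 2 (fun xs => pr (nth 0 xs 0) (nth 0 xs 1)).
Proof. by rewrite /pr; computability. Qed.
#[local] Hint Resolve computable_pr : computable.

Lemma computable_pr1 : computable 1 (fun xs => pr1 (nth 0 xs 0)).
Proof. by rewrite /pr1; computability. Qed.

Lemma computable_pr2 : computable 1 (fun xs => pr2 (nth 0 xs 0)).
Proof. by rewrite /pr2; computability. Qed.
#[local] Hint Resolve computable_pr1 computable_pr2 : computable.

(** A number [L] stands for the finite set of positions of its binary ones. *)
Definition bit (L x : nat) : bool := odd (L %/ 2 ^ x).

Lemma computable_bit : computable 2 (fun xs => bit (nth 0 xs 0) (nth 0 xs 1)).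
Proof. by rewrite /bit; computability. Qed.
#[local] Hint Resolve computable_bit : computable.

(** This bounds every search through the set coded by [L]. *)
Lemma bit_lt L x : bit L x -> x < L.
Proof.
rewrite /bit; case: (leqP L x) => // Lx.
by rewrite divn_small //; apply: leq_ltn_trans Lx _; exact: ltn_expl.
Qed.

Lemma bit_exists (s : seq nat) : exists L, forall x, bit L x = (x \in s).
Proof.
pose F n := \sum_(i < n) (nat_of_ord i \in s) * 2 ^ i.
have Fb n x : bit (F n) x = (x < n) && (x \in s).
  rewrite /bit /F; elim: n => [|n IH]; first by rewrite big_ord0 div0n.
  have Fn : \sum_(i < n) (nat_of_ord i \in s) * 2 ^ i < 2 ^ n.
    elim: n {IH} => [|n IH]; first by rewrite big_ord0.
    rewrite big_ord_recr /= expnS mul2n -addnn.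
    apply: (leq_trans (n := 2 ^ n + (n \in s) * 2 ^ n)).
      by rewrite ltn_add2r.
    by rewrite leq_add2l; case: (n \in s); rewrite ?mul1n ?mul0n.
  rewrite big_ord_recr /=; case: (ltngtP x n) => [xn|nx|->].
  - rewrite ltnS (ltnW xn) /= -[in 2 ^ n](subnK (ltnW xn)) expnD mulnA.
    rewrite addnC divnMDl ?expn_gt0 // oddD oddM oddX /= orbF.
    by rewrite subn_eq0 leqNgt xn andbF /= IH xn.
  - rewrite ltnS leqNgt nx /= divn_small //.
    apply: leq_trans (_ : 2 ^ n.+1 <= _); last by rewrite leq_exp2l.
    rewrite expnS mul2n -addnn -addSn leq_add //.
    by case: (n \in s); rewrite ?mul1n ?mul0n.
  - rewrite ltnSn /= addnC divnMDl ?expn_gt0 // divn_small // addn0.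
    by case: (n \in s).
exists (F (\max_(x <- s) x).+1) => x; rewrite Fb ltnS.
by case xs: (x \in s); rewrite ?andbF // andbT (big_rem _ xs) leq_maxl.
Qed.

(** The successor separates nonempty lists from the empty one, coded by 0; [hd] and [tl] send 0 to
    0, in agreement with [head 0] and [behead]. *)
Definition cns (x l : nat) : nat := (pr x l).+1.
Definition hd (l : nat) : nat := pr1 l.-1.
Definition tl (l : nat) : nat := pr2 l.-1.
Fixpoint encl (s : seq nat) : nat := if s is x :: s' then cns x (encl s') else 0.

Fixpoint enc (f : recfun) : nat :=
  match f with
  | Zero => pr 0 0
  | Succ => pr 1 0
  | Proj i => pr 2 i
  | Comp g hs => pr 3 (pr (enc g) (encl [seq enc h | h <- hs]))
  | Prec g s => pr 4 (pr (enc g) (enc s))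
  | Mu g => pr 5 (enc g)
  end.

Lemma hd_encl s : hd (encl s) = head 0 s.
Proof. by case: s => [|x s] //=;
  rewrite /hd /= ?pr1K //= /pr1 /nsum !big_ord_recl !big_ord0. Qed.

Lemma tl_encl s : tl (encl s) = encl (behead s).
Proof. by case: s => [|x s] //=;
  rewrite /tl /= ?pr2K //= /pr2 /nsum !big_ord_recl !big_ord0. Qed.

Lemma hd_cns x l : hd (cns x l) = x.
Proof. by rewrite /hd /cns /= pr1K. Qed.

Lemma tl_cns x l : tl (cns x l) = l.
Proof. by rewrite /tl /cns /= pr2K. Qed.

Definition fact (c l y : nat) : nat := pr c (pr l y).

Lemma computable_fact : computable 3 (fun xs => fact (nth 0 xs 0) (nth 0 xs 1) (nth 0 xs 2)).
Proof. by rewrite /fact; computability. Qed.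
Lemma computable_cns : computable 2 (fun xs => cns (nth 0 xs 0) (nth 0 xs 1)).
Proof. by rewrite /cns; computability. Qed.
Lemma computable_hd : computable 1 (fun xs => hd (nth 0 xs 0)).
Proof. by rewrite /hd; computability. Qed.
Lemma computable_tl : computable 1 (fun xs => tl (nth 0 xs 0)).
Proof. by rewrite /tl; computability. Qed.
#[local] Hint Resolve computable_fact computable_cns computable_hd computable_tl : computable.

Definition itl (i l : nat) : nat := nat_rect _ l (fun _ h => tl h) i.

Lemma computable_itl : computable 2 (fun xs => itl (nth 0 xs 0) (nth 0 xs 1)).
Proof.
rewrite /itl; apply: (computable_rec (G := fun xs => nth 0 xs 1)
  (S := fun _ h _ => tl h)); computability.
Qed.
#[local] Hint Resolve computable_itl : computable.

Lemma hd_itl i s : hd (itl i (encl s)) = nth 0 s i.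
Proof.
rewrite -[i in nth _ _ i]addn0 -nth_drop nth0 -hd_encl; congr hd.
elim: i => [|i IH] /=; first by rewrite drop0.
by rewrite IH tl_encl -drop1 drop_drop.
Qed.

(* A finite set of facts "program [c] maps the argument list [l] to [y]" is a
   derivation when each of its members is justified by members.  The tag 6
   marks a list of programs evaluated on a common argument list. *)
Definition justP (S : nat -> Prop) (c l y : nat) : Prop :=
  let a := pr2 c in
  match pr1 c with
  | 0 => y = 0
  | 1 => y = (hd l).+1
  | 2 => y = hd (itl a l)
  | 3 => exists zs, S (fact (pr 6 (pr2 a)) l zs) /\ S (fact (pr1 a) zs y)
  | 4 => if hd l is n.+1 then
           exists z, S (fact c (cns n (tl l)) z) /\
                     S (fact (pr2 a) (cns n (cns z (tl l))) y)
         else S (fact (pr1 a) (tl l) y)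
  | 5 => S (fact a (cns y l) 0) /\
         forall i, i < y -> exists z, S (fact a (cns i l) z.+1)
  | 6 => if a is b.+1 then
           [/\ y = cns (hd y) (tl y), S (fact (pr1 b) l (hd y)) &
               S (fact (pr 6 (pr2 b)) l (tl y))]
         else y = 0
  | _ => False
  end.

(** The decidable form of [justP] for the set coded by [L]: the searched values are outputs of facts
    in the set, hence below [L]. *)
Definition justb (L c l y : nat) : bool :=
  let a := pr2 c in
  [|| (pr1 c == 0) && (y == 0),
      (pr1 c == 1) && (y == (hd l).+1),
      (pr1 c == 2) && (y == hd (itl a l)),
      (pr1 c == 3) && bex L (fun zs =>
        bit L (fact (pr 6 (pr2 a)) l zs) && bit L (fact (pr1 a) zs y)),
      [&& pr1 c == 4, hd l == 0 & bit L (fact (pr1 a) (tl l) y)],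
      [&& pr1 c == 4, 0 < hd l & bex L (fun z =>
        bit L (fact c (cns (hd l).-1 (tl l)) z) &&
        bit L (fact (pr2 a) (cns (hd l).-1 (cns z (tl l))) y))],
      [&& pr1 c == 5, bit L (fact a (cns y l) 0) &
          ball y (fun i => bex L (fun z => bit L (fact a (cns i l) z.+1)))],
      [&& pr1 c == 6, a == 0 & y == 0] |
      [&& pr1 c == 6, 0 < a, y == cns (hd y) (tl y),
          bit L (fact (pr1 a.-1) l (hd y)) &
          bit L (fact (pr 6 (pr2 a.-1)) l (tl y))]].

Lemma computable_justb :
  computable 4 (fun xs => justb (nth 0 xs 0) (nth 0 xs 1) (nth 0 xs 2) (nth 0 xs 3)).
Proof. by rewrite /justb; computability. Qed.

Lemma bit_fact_out L c l y : bit L (fact c l y) -> y < L.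
Proof.
move/bit_lt; apply: leq_ltn_trans; apply: leq_trans (leq_pr2 c _); exact: leq_pr2.
Qed.

Lemma bex_bit L c l (b : nat -> bool) :
  (exists y, bit L (fact c l y) /\ b y) <->
  bex L (fun y => bit L (fact c l y) && b y).
Proof.
split=> [[y [Ly by_]]|/bexP [y _ /andP [Ly by_]]]; last by exists y.
by apply/bexP; exists y; rewrite ?Ly //; exact: bit_fact_out Ly.
Qed.

Lemma justbP L c l y : reflect (justP (bit L) c l y) (justb L c l y).
Proof.
rewrite /justP /justb; case: (pr1 c) => [|[|[|[|[|[|[|n]]]]]]] /=;
  rewrite ?orbF ?orFb; try exact: eqP.
- by apply: (equivP idP); rewrite -bex_bit.
- case: (hd l) => [|n] /=; first by rewrite orbF; exact: idP.
  by apply: (equivP idP); rewrite -bex_bit.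
- apply: (iffP andP) => [[L0 /ballP H]|[L0 H]]; split => //.
    by move=> i /H /bexP [z _ Lz]; exists z.
  apply/ballP => i /H [z Lz]; apply/bexP; exists z => //.
  exact: ltnW (bit_fact_out Lz).
- case: (pr2 c) => [|b] /=; first by rewrite orbF; exact: eqP.
  by apply: (iffP and3P) => -[/eqP ? ? ?]; split => //; apply/eqP.
- by right.
Qed.

Lemma justP_mono (S S' : nat -> Prop) c l y :
  (forall x, S x -> S' x) -> justP S c l y -> justP S' c l y.
Proof.
move=> SS'; rewrite /justP; case: (pr1 c) => [|[|[|[|[|[|[|n]]]]]]] //=.
- by case=> zs [/SS' ? /SS' ?]; exists zs.
- by case: (hd l) => [/SS'|n [z [/SS' ? /SS' ?]]] //; exists z.
- by case=> /SS' ? H; split=> // i /H [z /SS' ?]; exists z.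
- by case: (pr2 c) => // b [? /SS' ? /SS' ?].
Qed.

(** * Soundness and completeness of derivations *)

Definition derivation (S : nat -> Prop) : Prop :=
  forall c l y, S (fact c l y) -> justP S c l y.

(** Circular justification is impossible: each premise concerns a subprogram, a shorter list of
    programs, or the same [Prec] with a smaller recursion argument. *)
Lemma derivation_sound S : derivation S ->
  forall f xs y, S (fact (enc f) (encl xs) y) -> evalsto f xs y.
Proof.
move=> dS f; elim/recfun_nested_ind: f => [||i|g hs IHg IHhs|g s IHg IHs|g IHg] xs y /dS;
  rewrite /justP /= !(pr1K, pr2K).
- by [].
- by rewrite hd_encl.
- by rewrite hd_itl.
- case=> l [Shs Sg]; apply/evalsto_Comp.
  suff [zs el zsP] : exists2 zs, l = encl zs & evalall xs hs zs.
    by exists zs; split=> //; apply: IHg; rewrite -el.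
  elim: hs l IHhs Shs {Sg} => [|h hs IH] l /= IHhs /dS; rewrite /justP !(pr1K, pr2K).
    by move=> ->; exists [::].
  rewrite /cns !(pr1K, pr2K) => -[lE Sh Shs]; case: IHhs => IHh IHhs.
  have [zs el zsP] := IH _ IHhs Shs.
  by exists (hd l :: zs) => /=; [rewrite -el; exact: lE | split=> //; exact: IHh].
- move=> H.
  suff [h [h0 hS hy]] : exists h, [/\ evalsto g (behead xs) (h 0),
      forall i, i < head 0 xs -> evalsto s [:: i, h i & behead xs] (h i.+1)
      & y = h (head 0 xs)] by exists h.
  move: H; rewrite hd_encl tl_encl.
  elim: (head 0 xs) y => [|n IH] y.
    by move=> /IHg gy; exists (fun=> y).
  case=> z [/dS + Ss]; rewrite /justP !(pr1K, pr2K) /hd /tl /cns !(pr1K, pr2K).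
  move=> /IH [h [h0 hS hz]].
  (* The history up to [n] is extended by the value [y] at [n.+1]. *)
  exists (fun i => if i <= n then h i else y); split=> //; last by rewrite ltnn.
  move=> i; rewrite ltnS leq_eqVlt => /orP [/eqP ->|lin].
    by rewrite eqxx ltnn /= -hz; exact: (IHs [:: _, _ & _]).
  by rewrite lin orbT; exact: hS.
- case=> S0 H; split; first exact: (IHg (_ :: _)).
  by move=> i /H [z Sz]; exists z; exact: (IHg (_ :: _)).
Qed.

Definition derivable (x : nat) : Prop :=
  exists s : seq nat, derivation (fun z => z \in s) /\ x \in s.

Lemma derivation_cat (s1 s2 : seq nat) :
  derivation (fun z => z \in s1) -> derivation (fun z => z \in s2) ->
  derivation (fun z => z \in s1 ++ s2).
Proof.
move=> d1 d2 c l y; rewrite mem_cat => /orP [/d1|/d2];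
  by apply: justP_mono => x xs; rewrite mem_cat xs ?orbT.
Qed.

Lemma derivable2 x1 x2 : derivable x1 -> derivable x2 ->
  exists s : seq nat, [/\ derivation (fun z => z \in s), x1 \in s & x2 \in s].
Proof.
move=> [s1 [d1 m1]] [s2 [d2 m2]]; exists (s1 ++ s2).
by split; [exact: derivation_cat | rewrite mem_cat m1 | rewrite mem_cat m2 orbT].
Qed.

(** A justification uses finitely many premises; their derivations, joined and enlarged by the new
    fact, form a finite derivation. *)
Lemma derivable_step c l y : justP derivable c l y -> derivable (fact c l y).
Proof.
move=> J; suff [s [ds js]] : exists s : seq nat, derivation (fun z => z \in s) /\
    justP (fun z => z \in s) c l y.
  exists (fact c l y :: s); split; last exact: mem_head.
  move=> c' l' y'; rewrite inE => /orP [/eqP e|/ds]; last first.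
    by apply: justP_mono => x xs; rewrite inE xs orbT.
  case: (pr_inj e) => -> /pr_inj [-> ->].
  by apply: justP_mono js => x xs; rewrite inE xs orbT.
move: J; rewrite /justP; case: (pr1 c) => [|[|[|[|[|[|[|n]]]]]]] //=.
- by move=> ->; exists [::].
- by move=> ->; exists [::].
- by move=> ->; exists [::].
- by case=> zs [d1 d2]; have [s [? ? ?]] := derivable2 d1 d2; exists s; split=> //;
  exists zs.
- case: (hd l) => [[s sP]|n [z [d1 d2]]]; first by exists s.
  by have [s [? ? ?]] := derivable2 d1 d2; exists s; split=> //; exists z.
- case=> [[s0 [d0 m0]]] H.
  (* One derivation serving all the finitely many arguments below [y], by successive unions. *)
  have [s1 [d1 m1]] : exists s1 : seq nat, derivation (fun z => z \in s1) /\
      forall i, i < y -> exists z, fact (pr2 c) (cns i l) z.+1 \in s1.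
    elim: {m0} y H => [|y IH] H; first by exists [::].
    have [s1 [d1 m1]] := IH (fun i ilt => H i (ltnW ilt)).
    have [z [s2 [d2 m2]]] := H y (ltnSn y).
    exists (s1 ++ s2); split; first exact: derivation_cat.
    move=> i; rewrite ltnS leq_eqVlt => /orP [/eqP ->|/m1 [w mw]].
      by exists z; rewrite mem_cat m2 orbT.
    by exists w; rewrite mem_cat mw.
  exists (s0 ++ s1); split; first exact: derivation_cat.
  split=> [|i /m1 [z mz]]; first by rewrite mem_cat m0.
  by exists z; rewrite mem_cat mz orbT.
- case: (pr2 c) => [->|b [e d1 d2]]; first by exists [::].
  by have [s [? ? ?]] := derivable2 d1 d2; exists s.
Qed.

Lemma derivation_complete f xs y :
  evalsto f xs y -> derivable (fact (enc f) (encl xs) y).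
Proof.
elim/recfun_nested_ind: f xs y => [||i|g hs IHg IHhs|g s IHg IHs|g IHg] xs y.
- by move=> ->; apply: derivable_step; rewrite /justP /= pr1K.
- by move=> ->; apply: derivable_step; rewrite /justP /= pr1K hd_encl.
- by move=> ->; apply: derivable_step; rewrite /justP /= pr1K pr2K hd_itl.
- move=> /evalsto_Comp [zs [hzs /IHg gy]]; apply: derivable_step.
  rewrite /justP /= pr1K !(pr1K, pr2K); exists (encl zs); split=> //.
  elim: hs IHhs zs hzs {gy} => [|h hs IH] /= IHhs [|z zs] //.
    by move=> _; apply: derivable_step; rewrite /justP /= pr1K pr2K.
  case: IHhs => IHh /IH {}IH [/IHh hz /IH hzs]; apply: derivable_step.
  by rewrite /justP /= pr1K pr2K /cns /hd /tl !(pr1K, pr2K).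
- case=> h [/IHg h0 hS ->]; have {}hS i : i < head 0 xs ->
      derivable (fact (enc s) (cns i (cns (h i) (encl (behead xs)))) (h i.+1)).
    by move=> /hS /IHs.
  (* Generalised over the coded argument list, because the recursion lowers its first entry and
     keeps its tail. *)
  have : forall l, hd l <= head 0 xs -> tl l = encl (behead xs) ->
      derivable (fact (enc (Prec g s)) l (h (hd l))).
    move=> l; move En : (hd l) => n; elim: n l En => [|n IH] l En ln tll;
      apply: derivable_step; rewrite /justP /= pr1K !(pr1K, pr2K) En tll //.
    exists (h n); split; last exact: hS.
    by apply: IH; [exact: hd_cns | exact: ltnW | exact: tl_cns].
  by move=> /(_ (encl xs)); rewrite hd_encl tl_encl; apply.
- case=> /IHg g0 H; apply: derivable_step; rewrite /justP /= pr1K pr2K; split=> //.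
  by move=> i /H [z /IHg]; exists z.
Qed.

(** The certificate [L] is a derivation containing some output of [e] on [l]. The shape test skips
    members that are not facts, which exist because [pr] is not surjective. *)
Definition kleeneT (e l L : nat) : bool :=
  ball L (fun x =>
    ~~ (bit L x && (x == fact (pr1 x) (pr1 (pr2 x)) (pr2 (pr2 x)))) ||
    justb L (pr1 x) (pr1 (pr2 x)) (pr2 (pr2 x))) &&
  bex L (fun y => bit L (fact e l y)).

#[local] Hint Resolve computable_justb : computable.
Lemma computable_kleeneT :
  computable 3 (fun xs => kleeneT (nth 0 xs 0) (nth 0 xs 1) (nth 0 xs 2)).
Proof. by rewrite /kleeneT; computability. Qed.
#[local] Hint Resolve computable_kleeneT : computable.

Lemma kleene_normal_form f xs :
  halts f xs <-> exists t, kleeneT (enc f) (encl xs) t.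
Proof.
split=> [[y /derivation_complete [s [ds ms]]]|[L /andP [/ballP HL /bexP [y _ Ly]]]].
  have [L Ls] := bit_exists s; have dL : derivation (bit L).
    by move=> c l z; rewrite Ls => /ds; apply: justP_mono => x; rewrite Ls.
  have {}Ly : bit L (fact (enc f) (encl xs) y) by rewrite Ls.
  exists L; apply/andP; split; last first.
    by apply/bexP; exists y => //; exact: bit_fact_out Ly.
  apply/ballP => x _; case: andP => //= -[Lx /eqP xE]; apply/justbP/dL.
  by rewrite -xE.
exists y; apply: (@derivation_sound (bit L)) => // c l z Lx.
have := HL _ (bit_lt Lx).
by rewrite /fact !(pr1K, pr2K) -/(fact c l z) eqxx Lx /= => /justbP.
Qed.

(** * Strings and the acceptance test *)

Lemma code_cat w v : code (w ++ v) = code w + 2 ^ size w * code v.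
Proof.
elim: w => [|b w IH] /=; first by rewrite mul1n.
by rewrite IH expnS; lia.
Qed.

Lemma code_inj : injective code.
Proof.
elim=> [|b w IH] [|c v] //= [e]; have [bc wv] : b = c /\ code w = code v.
  by case: b c e => -[]; lia.
by rewrite bc (IH _ wv).
Qed.

Lemma code_surj n : exists w, code w == n.
Proof.
elim/ltn_ind: n => -[_|n IH]; first by exists [::].
have [|w /eqP wP] := IH n./2; first by lia.
by exists (odd n :: w); rewrite /= wP; apply/eqP; lia.
Qed.

Definition decode (n : nat) : seq bool := xchoose (code_surj n).

Lemma decodeK n : code (decode n) = n.
Proof. exact/eqP/(xchooseP (code_surj n)). Qed.

Lemma codeK w : decode (code w) = w.
Proof. exact/code_inj/decodeK. Qed.

Lemma code_bounds w : 2 ^ size w <= (code w).+1 < 2 ^ (size w).+1.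
Proof. by elim: w => //= b w; rewrite !expnS; case: b; lia. Qed.

Lemma size_code w : size w <= code w.
Proof. by elim: w => //= b w; lia. Qed.

(** This is the floor of log2(n + 1), the length in bijective base 2; the range suffices because a
    string is no longer than its code. *)
Definition clen (n : nat) : nat := nsum n (fun i => 2 ^ i.+1 <= n.+1).

Lemma clen_code w : clen (code w) = size w.
Proof.
have lt i : (2 ^ i.+1 <= (code w).+1) = (i < size w).
  have /andP [lo hi] := code_bounds w; apply/idP/idP => [le|lt].
    by rewrite -ltnS -(ltn_exp2l _ _ (ltnSn 1)); exact: leq_ltn_trans hi.
  by apply: leq_trans lo; rewrite leq_exp2l.
rewrite /clen; under eq_nsum => i do rewrite lt.
have : forall n, nsum n (fun i => i < size w) = minn n (size w).
  move=> n; rewrite /nsum; elim: n => [|n IH]; first by rewrite big_ord0 min0n.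
  by rewrite big_ord_recr /= IH; case: ltnP; lia.
by move=> ->; apply/minn_idPr; exact: size_code.
Qed.

Lemma clen_decode n : clen n = size (decode n).
Proof. by rewrite -{1}[n]decodeK clen_code. Qed.

Definition ccat (a c : nat) : nat := a + 2 ^ clen a * c.

Lemma ccat_code w v : ccat (code w) (code v) = code (w ++ v).
Proof. by rewrite /ccat clen_code code_cat. Qed.

Definition cprefix (a c : nat) : bool := bex c.+1 (fun u => c == ccat a u).

Lemma cprefix_code w v : cprefix (code w) (code v) = prefix w v.
Proof.
apply/bexP/prefixP => [[u _ /eqP]|[u vE]].
  by rewrite -(decodeK u) ccat_code => /code_inj ->; exists (decode u).
exists (code u); rewrite ?ccat_code -?vE ?eqxx // ltnS vE code_cat.
by apply: leq_trans (leq_addl _ _); rewrite leq_pmull // expn_gt0.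
Qed.

Lemma computable_clen : computable 1 (fun xs => clen (nth 0 xs 0)).
Proof. by rewrite /clen; computability. Qed.
#[local] Hint Resolve computable_clen : computable.

Lemma computable_ccat : computable 2 (fun xs => ccat (nth 0 xs 0) (nth 0 xs 1)).
Proof. by rewrite /ccat; computability. Qed.
#[local] Hint Resolve computable_ccat : computable.

Lemma computable_cprefix : computable 2 (fun xs => cprefix (nth 0 xs 0) (nth 0 xs 1)).
Proof. by rewrite /cprefix; computability. Qed.
#[local] Hint Resolve computable_cprefix : computable.

(* Stage [u] enumerates the string coded by [pr1 u] when [pr2 u] is the least
   halting certificate of the program [e] on the arguments [pr1 u; 1; 0]. *)
Definition halting (e x t : nat) : bool := kleeneT e (encl [:: x; 1; 0]) t.

Definition enumerates (e u : nat) : bool :=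
  [&& u == pr (pr1 u) (pr2 u), halting e (pr1 u) (pr2 u) &
      ~~ bex (pr2 u) (fun t => halting e (pr1 u) t)].

Definition enum_count (e n t : nat) : nat :=
  nsum t (fun u => enumerates e u && (clen (pr1 u) == n)).

(** [enum_count] counts the earlier strings of the same length n, so the current one is tested to be
    among the first ((2m+1)/(m+2))^n, with denominators cleared. *)
Definition accepts (e m u : nat) : bool :=
  enumerates e u &&
  ((enum_count e (clen (pr1 u)) u).+1 * m.+2 ^ clen (pr1 u)
     <= m.*2.+1 ^ clen (pr1 u)).

Definition accepted (e m : nat) (w : seq bool) : Prop :=
  exists u, accepts e m u /\ pr1 u = code w.

Lemma computable_halting : computable 3 (fun xs => halting (nth 0 xs 0) (nth 0 xs 1) (nth 0 xs 2)).
Proof. by rewrite /halting /=; computability. Qed.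
#[local] Hint Resolve computable_halting : computable.

Lemma computable_enumerates : computable 2 (fun xs => enumerates (nth 0 xs 0) (nth 0 xs 1)).
Proof. by rewrite /enumerates; computability. Qed.
#[local] Hint Resolve computable_enumerates : computable.

Lemma computable_enum_count :
  computable 3 (fun xs => enum_count (nth 0 xs 0) (nth 0 xs 1) (nth 0 xs 2)).
Proof. by rewrite /enum_count; computability. Qed.
#[local] Hint Resolve computable_enum_count : computable.

Lemma computable_double : computable 1 (fun xs => (nth 0 xs 0).*2).
Proof. by apply: (computable_ext (F := fun xs => 2 * nth 0 xs 0)) => [xs|];
  [rewrite mul2n|computability]. Qed.
#[local] Hint Resolve computable_double : computable.

Lemma computable_accepts :
  computable 3 (fun xs => accepts (nth 0 xs 0) (nth 0 xs 1) (nth 0 xs 2)).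
Proof. by rewrite /accepts; computability. Qed.
#[local] Hint Resolve computable_accepts : computable.

(** Only the least certificate counts, so a string appears at one stage and counting stages counts
    strings. *)
Lemma enumerates_pr1_inj e u u' :
  enumerates e u -> enumerates e u' -> pr1 u = pr1 u' -> u = u'.
Proof.
move=> /and3P [/eqP uE hu mu] /and3P [/eqP uE' hu' mu'] e1.
rewrite uE uE' -e1; congr pr; rewrite -e1 in hu' mu'.
case: (ltngtP (pr2 u) (pr2 u')) => // lt.
  by case/bexP: mu'; exists (pr2 u).
by case/bexP: mu; exists (pr2 u').
Qed.

Lemma enumerates_halting e x :
  (exists t, halting e x t) <-> exists2 u, enumerates e u & pr1 u = x.
Proof.
split=> [ex|[u /and3P [_ hu _] <-]]; last by exists (pr2 u).
case: (ex_minnP ex) => t ht tmin; exists (pr x t); last exact: pr1K.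
rewrite /enumerates !(pr1K, pr2K) eqxx ht /=; apply/bexP => -[i ilt hi].
by have := tmin i hi; rewrite leqNgt ilt.
Qed.

Lemma accepts_size e m u : accepts e m u -> size (decode (pr1 u)) <= u.
Proof.
move=> /andP [/and3P [/eqP uE _ _] _]; rewrite [leqRHS]uE.
apply: leq_trans (leq_pr1 _ _); rewrite -{2}(decodeK (pr1 u)); exact: size_code.
Qed.

(** At an accepting stage the test bounds one more than the number of strings enumerated before,
    hence also the new number of accepted ones; the induction therefore carries both counts. *)
Lemma accepts_count e m n t :
  nsum t (fun u => accepts e m u && (clen (pr1 u) == n)) * m.+2 ^ n <= m.*2.+1 ^ n.
Proof.
set F := fun u => _.
suff [_] : nsum t F <= enum_count e n t /\ nsum t F * m.+2 ^ n <= m.*2.+1 ^ n by [].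
rewrite /enum_count; elim: t => [|t [le1 le2]].
  by rewrite /nsum !big_ord0 mul0n.
have S1 G : nsum t.+1 G = nsum t G + G t by rewrite /nsum big_ord_recr.
have Ft : F t = (accepts e m t && (clen (pr1 t) == n)) by [].
rewrite !S1 Ft; split.
  apply: leq_add => //; rewrite /accepts; case: (enumerates e t) => //=.
  by case: eqP; rewrite ?andbF ?andbT // leq_b1.
case: andP => [[/andP [_ +] /eqP en]|_]; last by rewrite addn0.
rewrite en addn1; apply: leq_trans; rewrite leq_mul2r ltnS.
by rewrite le1 orbT.
Qed.

(** * Gales *)

Local Open Scope classical_set_scope.
Local Open Scope ring_scope.

Lemma succeeds_stronglyP (R : realType) (d : seq bool -> R) A :
  succeeds_strongly d A <->
  forall c, exists n0, forall n, (n0 <= n)%N -> c < d (mkseq A n).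
Proof.
rewrite /succeeds_strongly limn_einf_lim; set u := fun n => _.
have -> : limn (einfs u) = ereal_sup (range (einfs u)).
  by apply/cvg_lim => //; exact: cvg_einfs_sup.
split=> [supy c|H].
  have : (c%:E < ereal_sup (range (einfs u)))%E by rewrite supy ltry.
  move=> /ereal_sup_gt [_ [n0 _ <-] cn0]; exists n0 => n nn0.
  rewrite -lte_fin; apply: lt_le_trans cn0 _; apply: ereal_inf_lbound.
  by exists n.
apply/eqyP => c _; have [n0 n0P] := H c.
apply: (@le_trans _ _ (einfs u n0)); last first.
  by apply: ereal_sup_ubound; exists n0.
by apply: le_ereal_inf_tmp => _ [n /= /n0P cn <-]; rewrite lee_fin ltW.
Qed.

Lemma expr_unbounded (R : realType) (y c : R) : 1 < y ->
  exists n0, forall n, (n0 <= n)%N -> c < y ^+ n.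
Proof.
move=> y1; have y0 : 0 < y - 1 by rewrite subr_gt0.
have bern n : 1 + n%:R * (y - 1) <= y ^+ n.
  elim: n => [|n IH]; first by rewrite mul0r addr0 expr0.
  rewrite exprS; apply: le_trans (_ : y * (1 + n%:R * (y - 1)) <= _); last first.
    by rewrite ler_pM2l //; lra.
  have nt0 : 0 <= n%:R * (y - 1) ^+ 2 by rewrite mulr_ge0 ?ler0n ?sqr_ge0.
  rewrite -natr1 -subr_ge0; move: nt0; congr (_ <= _).
  by move: n%:R => a; ring.
pose n0 := (Num.truncn (c / (y - 1))).+1; exists n0 => n nn0.
apply: lt_le_trans (bern n).
have : c / (y - 1) < n%:R.
  apply: lt_le_trans (truncnS_gt _) _.
  by rewrite ler_nat.
by rewrite ltr_pdivrMr // => H; lra.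
Qed.

(* The gale condition with growth factor [x = 2 ^ s]. *)
Definition growth_gale (R : realType) (x : R) (d : seq bool -> R) : Prop :=
  (forall w, 0 <= d w) /\
  (forall w, x * d w = d (rcons w false) + d (rcons w true)).

Fixpoint strings (n : nat) : seq (seq bool) :=
  if n is n'.+1 then
    [seq rcons w false | w <- strings n'] ++ [seq rcons w true | w <- strings n']
  else [:: [::]].

Lemma mem_strings w : w \in strings (size w).
Proof.
elim/last_ind: w => // w b IH; rewrite size_rcons /= mem_cat.
by case: b; apply/orP; [right | left]; apply/mapP; exists w.
Qed.

Section GrowthGale.
Variables (R : realType) (x : R) (d : seq bool -> R).
Hypothesis gd : growth_gale x d.

Lemma gale_level_sum n : \sum_(w <- strings n) d w = x ^+ n * d [::].
Proof.
elim: n => [|n IH]; first by rewrite /= big_seq1 mul1r.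
rewrite /= big_cat /= !big_map -big_split /= exprS -mulrA -IH big_distrr.
by apply: eq_bigr => w _; rewrite -gd.2.
Qed.

(** A Kolmogorov-type inequality: the values on a whole level add up to [x ^+ n * d [::]], and all
    terms are nonnegative. *)
Lemma gale_uniq_sum n (l : seq (seq bool)) :
  uniq l -> (forall w, w \in l -> size w = n) ->
  \sum_(w <- l) d w <= x ^+ n * d [::].
Proof.
move=> ul ln; rewrite -gale_level_sum.
have : {subset l <= strings n} by move=> w /ln <-; exact: mem_strings.
elim: l ul (strings n) {ln} => [_ s _|w l IH /= /andP [wl ul] s ls].
  by rewrite big_nil sumr_ge0 // => w _; exact: gd.1.
have ws : w \in s by apply: ls; exact: mem_head.
rewrite big_cons (big_rem _ ws) lerD2l; apply: IH => // v vl.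
apply: rem_mem; last by apply: ls; rewrite inE vl orbT.
by apply: contraNneq wl => <-.
Qed.

Lemma gale_le_root w : d w <= x ^+ size w * d [::].
Proof.
have := @gale_uniq_sum (size w) [:: w] isT; rewrite big_seq1; apply.
by move=> v; rewrite inE => /eqP ->.
Qed.

Lemma gale_small_extension w (c : R) n : 0 <= x < 2 -> 0 < c ->
  exists v, [/\ prefix w v, (n <= size v)%N & d v < c].
Proof.
move=> /andP [x0 x2] c0.
have ext k : exists v, [/\ prefix w v, (k <= size v)%N & d v <= (x / 2) ^+ k * d w].
  elim: k => [|k [v [wv kv dv]]]; first by exists w; rewrite prefix_refl expr0 mul1r.
  (* The smaller successor is at most the average of the two, which is x / 2 times the current
     value. *)
  have [b db] : exists b, d (rcons v b) <= (x / 2) * d v.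
    have e := gd.2 v; case: (lerP (d (rcons v false)) (d (rcons v true))) => H.
      by exists false; lra.
    by exists true; lra.
  exists (rcons v b); split; last 1 first.
  - apply: le_trans db _; rewrite exprS -[leRHS]mulrA ler_wpM2l //; lra.
  - by apply: prefix_trans wv _; exact: prefix_rcons.
  - by rewrite size_rcons.
have [n0 n0P] : exists n0, forall k, (n0 <= k)%N -> (x / 2) ^+ k * d w < c.
  case: (eqVneq x 0) => [->|xn0].
    by exists 1%N => -[|k] // _; rewrite mul0r exprS mul0r mul0r.
  have xp : 0 < x / 2 by rewrite divr_gt0 // lt_neqAle eq_sym xn0.
  have [|n0 n0P] := @expr_unbounded R (x / 2)^-1 (d w / c).
    by rewrite invf_gt1 //; lra.
  exists n0 => k /n0P; rewrite exprVn ltr_pdivrMr // => H.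
  by rewrite mulrC -ltr_pdivlMr ?exprn_gt0 // mulrC.
have [v [wv nv dv]] := ext (maxn n n0); exists v; split=> //.
  by apply: leq_trans nv; exact: leq_maxl.
by apply: le_lt_trans dv _; apply: n0P; exact: leq_maxr.
Qed.

(** For a growth factor at most 1 the gale never exceeds its value at the root. *)
Lemma gale_growth_gt1 A : succeeds_strongly d A -> 0 <= x -> 1 < x.
Proof.
move=> /succeeds_stronglyP /(_ (d [::])) [n0 /(_ n0 (leqnn _)) H] x0.
rewrite ltNge; apply/negP => x1; have := gale_le_root (mkseq A n0).
apply/negP; rewrite -ltNge; apply: le_lt_trans H.
by rewrite ler_piMl ?gd.1 // exprn_ile1.
Qed.
End GrowthGale.

(** * The gale of an acceptance test *)

Lemma prefix_rcons_nth (w z : seq bool) b : (size w < size z)%N ->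
  prefix (rcons w b) z = prefix w z && (nth false z (size w) == b).
Proof. by move=> lt; rewrite !prefixE size_rcons (take_nth false) // eqseq_rcons. Qed.

Lemma prefix_size_eq (w z : seq bool) : size w = size z -> prefix w z = prefix z w.
Proof. by move=> e; rewrite !prefixE e take_size -e take_size eq_sym. Qed.

Section Mixture.
Variables (R : realType) (m : nat) (acc : nat -> bool) (v : nat -> seq bool).
Hypothesis acc_size : forall u, acc u -> (size (v u) <= u)%N.
Hypothesis acc_count : forall n t,
  (nsum t (fun u => acc u && (size (v u) == n)) * m.+2 ^ n <= m.*2.+1 ^ n)%N.

(** With rho = (2m+1)/(m+2), the growth rate of the accepted strings, one has rho < tau < sigma < 2.
    The first inequality makes the weighted sum converge, the second makes it unbounded along
    accepted prefixes, the third keeps the dimension below 1. *)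
Definition sigma : R := (m.*2.+3)%:R / m.+2%:R.
Definition tau : R := (m.*2.+2)%:R / m.+2%:R.

Lemma sigma_gt0 : 0 < sigma. Proof. by rewrite divr_gt0 // ltr0n. Qed.
Lemma tau_gt0 : 0 < tau. Proof. by rewrite divr_gt0 // ltr0n. Qed.

Lemma sigma_lt2 : sigma < 2.
Proof. by rewrite ltr_pdivrMr ?ltr0n // -natrM ltr_nat; lia. Qed.

Lemma sigma_tau_gt1 : 1 < sigma / tau.
Proof.
by rewrite ltr_pdivlMr ?tau_gt0 // mul1r ltr_pM2r ?invr_gt0 ?ltr0n // ltr_nat.
Qed.

Definition compatible (w z : seq bool) : bool :=
  if (size w < size z)%N then prefix w z else prefix z w.

(* The gale with growth [sigma] that bets on [z] up to its length and then
   splits evenly, scaled to be [(sigma / tau) ^ size z] at [z]. *)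
Definition kern (z w : seq bool) : R :=
  sigma ^+ size w * tau^-1 ^+ size z * 2^-1 ^+ (size w - size z) * (compatible w z)%:R.

Lemma kern_gale z : growth_gale sigma (kern z).
Proof.
split=> [w|w]; first by rewrite !mulr_ge0 // ?exprn_ge0 ?invr_ge0 ?(ltW sigma_gt0) ?(ltW tau_gt0).
rewrite /kern /compatible !size_rcons exprS.
case: (ltnP (size w) (size z)) => [lt|le].
  (* Before the end of [z] all capital goes to the next bit of [z]. If the successor already has the
     length of [z], both prefix tests agree. *)
  have zw b : (if ((size w).+1 < size z)%N then prefix (rcons w b) z
               else prefix z (rcons w b)) = prefix w z && (nth false z (size w) == b).
    case: ltnP => le; last rewrite prefix_size_eq ?size_rcons; try lia.
      by rewrite prefix_rcons_nth.
    by rewrite prefix_rcons_nth.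
  rewrite !zw (eqP (lt : (size w).+1 - size z == 0)%N) (eqP (ltnW lt : size w - size z == 0)%N).
  by rewrite !expr0; case: (prefix w z); case: (nth false z (size w)) => /=; ring.
(* From the length of [z] on, both successors have the same compatibility and receive equal
   shares. *)
have zw b : prefix z (rcons w b) = prefix z w.
  by rewrite !prefixE -cats1 takel_cat.
rewrite !zw (subSn le) exprS ltnNge (leq_trans le) //=.
set a := 2^-1 ^+ _; set c := sigma ^+ _; set e := tau^-1 ^+ _.
by case: (prefix z w) => /=; field.
Qed.

Definition approx (t : nat) (w : seq bool) : R :=
  \sum_(u < t | acc u) kern (v u) w.

Lemma approx_gale t : growth_gale sigma (approx t).
Proof.
split=> w; first by rewrite sumr_ge0 // => u _; exact: (kern_gale _).1.
by rewrite big_distrr -big_split; apply: eq_bigr => u _ /=; rewrite (kern_gale _).2.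
Qed.

Lemma approx_mono w : nondecreasing_seq (approx ^~ w).
Proof.
apply/nondecreasing_seqP => t; rewrite /approx [leRHS]big_mkcond big_ord_recr /=.
rewrite -big_mkcond /= lerDl; case: ifP => // _; exact: (kern_gale _).1.
Qed.

Lemma geometric_sum_le (q : R) n : 0 <= q < 1 -> \sum_(i < n) q ^+ i <= (1 - q)^-1.
Proof.
move=> /andP [q0 q1]; have q1' : 0 < 1 - q by lra.
rewrite -div1r ler_pdivlMr // mulrC; have -> : (1 - q) * \sum_(i < n) q ^+ i = 1 - q ^+ n.
  elim: n => [|n IH]; first by rewrite big_ord0 expr0; ring.
  by rewrite big_ord_recr /= mulrDr IH exprS; ring.
by rewrite lerBlDr lerDl exprn_ge0.
Qed.

(** Grouped by length n, the at most rho^n accepted strings contribute tau^-n each at the root; the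
    ratio [q] of the resulting geometric series is rho / tau. *)
Lemma approx_root_bounded : exists C, forall t, approx t [::] <= C.
Proof.
pose q : R := (m.*2.+1)%:R / (m.*2.+2)%:R.
have q0 : 0 <= q by rewrite divr_ge0.
have q1 : q < 1 by rewrite ltr_pdivrMr ?ltr0n // mul1r ltr_nat.
exists (1 - q)^-1 => t; apply: le_trans (geometric_sum_le t _); last by rewrite q0.
have -> : approx t [::] =
    \sum_(n < t) \sum_(u < t) (acc u && (size (v u) == n))%:R * tau^-1 ^+ n.
  rewrite exchange_big /= /approx big_mkcond; apply: eq_bigr => u _.
  case: ifP => [au|_]; last by rewrite big1 // => n _; rewrite mul0r.
  have lt : (size (v u) < t)%N by apply: leq_ltn_trans (acc_size au) _.
  rewrite (bigD1 (Ordinal lt)) //= eqxx mul1r big1 ?addr0; last first.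
    by move=> n; rewrite -val_eqE /= eq_sym => /negbTE ->; rewrite mul0r.
  rewrite /kern /compatible /= sub0n !expr0.
  by case: (v u) => [|b z] /=; rewrite ?prefix0s ?prefixs0 /= !(mulr1, mul1r).
apply: ler_sum => n _; rewrite -big_distrl /=.
have := acc_count n t; rewrite -(ler_nat R) natrM !natrX /nsum natr_sum => le.
rewrite /q /tau invf_div !expr_div_n.
rewrite ler_pdivlMr ?exprn_gt0 ?ltr0n // mulrA divfK ?expf_neq0 ?pnatr_eq0 //.
Qed.

Definition mixture (w : seq bool) : R := sup (range (approx ^~ w)).

Lemma approx_bounded w : has_ubound (range (approx ^~ w)).
Proof.
have [C CP] := approx_root_bounded; exists (sigma ^+ size w * C) => _ [t _ <-].
apply: le_trans (gale_le_root (approx_gale t) w) _.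
by rewrite ler_wpM2l // exprn_ge0 // ltW // sigma_gt0.
Qed.

Lemma approx_cvg w : approx ^~ w @ \oo --> mixture w.
Proof. by apply: nondecreasing_cvgn; [exact: approx_mono | exact: approx_bounded]. Qed.

Lemma approx_le_mixture t w : approx t w <= mixture w.
Proof. by apply: ub_le_sup; [exact: approx_bounded | exists t]. Qed.

Lemma lt_mixture x w : x < mixture w <-> exists t, x < approx t w.
Proof.
split=> [/sup_gt [|_ [t _ <-] lt]|[t lt]]; first by exists (approx 0 w), 0%N.
  by exists t.
exact: lt_le_trans lt (approx_le_mixture _ _).
Qed.

(** The gale identity of the finite sums passes to their limit. *)
Lemma mixture_gale : growth_gale sigma mixture.
Proof.
split=> w; first by apply: le_trans (approx_le_mixture 0 w); exact: (approx_gale 0).1.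
have c1 : (fun t => sigma * approx t w) @ \oo --> sigma * mixture w.
  by apply: cvgM; [exact: cvg_cst | exact: approx_cvg].
have c2 : (fun t => sigma * approx t w) @ \oo -->
    mixture (rcons w false) + mixture (rcons w true).
  under eq_fun => t do rewrite (approx_gale t).2.
  by apply: cvgD; exact: approx_cvg.
exact: (cvg_unique _ c1 c2).
Qed.

Lemma mixture_accepted u : acc u -> (sigma / tau) ^+ size (v u) <= mixture (v u).
Proof.
move=> au; apply: le_trans (approx_le_mixture u.+1 _).
rewrite /approx big_mkcond big_ord_recr /= au.
have -> : (sigma / tau) ^+ size (v u) = kern (v u) (v u).
  by rewrite /kern /compatible ltnn prefix_refl subnn expr0 !mulr1 exprMn.
rewrite lerDr sumr_ge0 // => i _; case: ifP => // _; exact: (kern_gale _).1.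
Qed.

(** A common denominator at [w] of all kernels of stages below [t]: their strings have length at
    most [t], and at most [size w] halvings occur. *)
Definition approx_den (t : nat) (w : seq bool) : nat :=
  (m.+2 ^ size w * m.*2.+2 ^ t * 2 ^ size w)%N.

Definition approx_num (t : nat) (w : seq bool) : nat :=
  nsum t (fun u => (acc u && compatible w (v u)) *
    (m.*2.+3 ^ size w * (m.+2 ^ size (v u) * m.*2.+2 ^ (t - size (v u))) *
     2 ^ (size w - (size w - size (v u)))))%N.

Lemma approxE t w : approx t w * (approx_den t w)%:R = (approx_num t w)%:R.
Proof.
rewrite /approx /approx_num /nsum natr_sum big_distrl /= [LHS]big_mkcond.
apply: eq_bigr => u _; case: ifP => [au|_]; last by rewrite mul0n.
rewrite /kern /= !natrM; case: (compatible w (v u)) => /=; last by rewrite mulr0 !mul0r.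
have lt : (size (v u) <= t)%N by apply: leq_trans (acc_size au) (ltnW _).
rewrite !natrX /sigma /tau invf_div exprVn !expr_div_n.
have -> : (m.*2.+2)%:R ^+ t = (m.*2.+2)%:R ^+ size (v u) * (m.*2.+2)%:R ^+ (t - size (v u)) :> R.
  by rewrite -exprD subnKC.
have -> : 2%:R ^+ size w = 2%:R ^+ (size w - size (v u)) *
    2%:R ^+ (size w - (size w - size (v u))) :> R.
  by rewrite -exprD subnKC // leq_subr.
have nz k n : k.+1%:R ^+ n != 0 :> R by rewrite expf_neq0 // pnatr_eq0.
have := nz 1%N (size w - size (v u))%N; have := nz m.*2.+1 (size (v u)).
have := nz m.+1 (size w).
move: (m.*2.+2%:R ^+ _) (m.*2.+2%:R ^+ _) (2%:R ^+ _) (2%:R ^+ _) => a b c d.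
move: (m.+2%:R ^+ _) (m.+2%:R ^+ _) (m.*2.+3%:R ^+ _) => a' b' c' h1 h2 h3.
by field; rewrite h1 h2 h3.
Qed.

(** A rational bound is exceeded at some finite stage, where the comparison is between natural
    numbers. *)
Lemma mixture_ratio a b w : a%:R / b.+1%:R < mixture w <->
  exists t, (a * approx_den t w < b.+1 * approx_num t w)%N.
Proof.
rewrite lt_mixture.
have E t : (a%:R / b.+1%:R < approx t w) = (a * approx_den t w < b.+1 * approx_num t w)%N.
  have den0 : 0 < (approx_den t w)%:R :> R by rewrite ltr0n !muln_gt0 !expn_gt0.
  rewrite ltr_pdivrMr ?ltr0n // -(ltr_pM2r den0) mulrAC approxE -!natrM ltr_nat.
  by rewrite [X in (_ < X)%N = _]mulnC.
by split=> -[t H]; exists t; [rewrite -E | rewrite E].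
Qed.
End Mixture.

(** * Strong dimension *)

Section Dimension.
Variable R : realType.
Implicit Types (d : seq bool -> R) (A : nat -> bool).

Definition lg (x : R) : R := ln x / ln 2.

Lemma ln2_gt0 : 0 < ln 2 :> R.
Proof. by rewrite ln_gt0 // ltr1n. Qed.

Lemma gale_lg x d : 0 < x -> growth_gale x d -> gale (lg x) d.
Proof.
move=> x0 gd; have e : 2 `^ lg x = x.
  by rewrite /powR pnatr_eq0 /lg divfK ?gt_eqF ?ln2_gt0 // lnK.
by rewrite /gale e.
Qed.

Lemma lg_lt1 x : 0 < x < 2 -> lg x < 1.
Proof.
by move=> /andP [x0 x2]; rewrite ltr_pdivrMr ?ln2_gt0 // mul1r ltr_ln // posrE.
Qed.

Lemma lower_semicomputableI d (P : nat -> nat -> nat -> nat -> bool) :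
  computable 4 (fun ys => P (nth 0%N ys 0) (nth 0%N ys 1) (nth 0%N ys 2) (nth 0%N ys 3)) ->
  (forall w a b, a%:R / b.+1%:R < d w <-> exists t, P t (code w) a b) ->
  lower_semicomputable d.
Proof.
move=> cP dP.
have [|f fP] := @halts_bool 3
  (fun t xs => P t (nth 0%N xs 0) (nth 0%N xs 1) (nth 0%N xs 2)).
  by apply: computable_ext cP => ys; rewrite !nth_behead.
by exists f => w a b; rewrite fP.
Qed.

(** Used twice: with [C] constantly true for gales that succeed everywhere, and with [C] deciding
    the prefixes of a computable sequence. *)
Lemma power_lower_semicomputable (p q : nat) (C : nat -> bool) :
  computable 1 (fun xs => C (nth 0%N xs 0)) ->
  lower_semicomputable (fun w => (p.+1%:R / q.+1%:R) ^+ size w * (C (code w))%:R : R).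
Proof.
move=> cC; apply: (@lower_semicomputableI _ (fun _ c a b =>
  C c && (a * q.+1 ^ clen c < b.+1 * p.+1 ^ clen c)%N)); first by computability.
move=> w a b; rewrite clen_code; case: (C (code w)) => /=; last first.
  rewrite mulr0; split=> [|[]//]; rewrite ltNge divr_ge0 //.
rewrite mulr1 expr_div_n ltr_pdivrMr ?ltr0n // mulrAC ltr_pdivlMr ?exprn_gt0 ?ltr0n //.
rewrite -!natrX -!natrM ltr_nat [X in (_ < X)%N]mulnC.
by split=> [|[]//]; exists 0%N.
Qed.

(** The dimension never exceeds 1, because the gales y^|w| with rational y > 1 succeed on every
    sequence and their growth 2y can be taken close to 2. Only the lower bound is at stake. *)
Lemma Dim_eq1P A : Dim R A = 1 <->
  forall s d, gale s d -> lower_semicomputable d -> succeeds_strongly d A -> 1 <= s.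
Proof.
rewrite /Dim; set S := [set s | _].
have lbS : has_lbound S.
  exists 0 => s [d [gd _ sd]]; rewrite leNgt; apply/negP => s0.
  have := gale_growth_gt1 gd sd (powR_ge0 _ _); apply/negP; rewrite -leNgt.
  by rewrite -[leRHS](powRr0 2) ler_powR // ?ler1n // ltW.
split=> [S1 s d gd ld sd|H]; first by rewrite -S1; apply: ge_inf => //; exists d.
have near1 k : S (lg (2 * (k.+2%:R / k.+1%:R))).
  have y1 : 1 < k.+2%:R / k.+1%:R :> R by rewrite ltr_pdivlMr ?ltr0n // mul1r ltr_nat.
  exists (fun w => (k.+2%:R / k.+1%:R) ^+ size w * true%:R); split.
  - apply: gale_lg; first by rewrite mulr_gt0 // (lt_trans ltr01).
    split=> w; first by rewrite mulr1 exprn_ge0 // ltW // (lt_trans ltr01).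
    by rewrite !size_rcons !exprS; ring.
  - by apply: (power_lower_semicomputable k.+1 k (C := fun=> true)); computability.
  - apply/succeeds_stronglyP => c; have [n0 n0P] := expr_unbounded c y1.
    by exists n0 => n /n0P; rewrite size_mkseq mulr1.
apply/eqP; rewrite eq_le; apply/andP; split; last first.
  by apply: lb_le_inf; [exists (lg (2 * (2%:R / 1%:R))); exact: near1
                       | move=> s [d [gd ld sd]]; exact: H sd].
apply/ler_addgt0Pr => e e0.
have p2 : 2 < 2 `^ (1 + e) :> R.
  by rewrite powRD ?pnatr_eq0 ?implybT // powRr1 // ltr_pMr // /powR
     pnatr_eq0 expR_gt1 mulr_gt0 ?ln2_gt0.
(* Chosen so that 2 (k+2)/(k+1) = 2 + 2/(k+1) is below 2^(1+e). *)
pose k := Num.truncn (2 / (2 `^ (1 + e) - 2) : R).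
apply: (@le_trans _ _ (lg (2 * (k.+2%:R / k.+1%:R)))); first by apply: ge_inf.
have y0 : 0 < 2 * (k.+2%:R / k.+1%:R) :> R by rewrite mulr_gt0 // divr_gt0.
rewrite /lg ler_pdivrMr ?ln2_gt0 // -[leRHS]ln_powR ler_ln ?posrE ?powR_gt0 //.
have := truncnS_gt (2 / (2 `^ (1 + e) - 2) : R); rewrite -/k.
rewrite ltr_pdivrMr ?subr_gt0 // => H2.
rewrite mulrA ler_pdivrMr ?ltr0n // -[k.+2%:R]natr1.
by move: H2; move: (2 `^ _) (k.+1%:R) => a b; lra.
Qed.

Lemma enum_countE e n t : enum_count e n t =
  count (fun u => enumerates e u && (clen (pr1 u) == n)) (iota 0 t).
Proof.
rewrite /enum_count /nsum; elim: t => [|t IH]; first by rewrite big_ord0.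
by rewrite -[in RHS](addn1 t) iotaD count_cat /= addn0 big_ord_recr /= IH.
Qed.

Definition accepted_gale (e m : nat) : seq bool -> R :=
  @mixture R m (accepts e m) (fun u => decode (pr1 u)).

Lemma accepts_count_decode e m n t :
  (nsum t (fun u => accepts e m u && (size (decode (pr1 u)) == n)) * m.+2 ^ n
     <= m.*2.+1 ^ n)%N.
Proof.
under eq_nsum => u do rewrite -clen_decode.
exact: accepts_count.
Qed.

Lemma accepted_gale_gale e m : growth_gale (sigma R m) (accepted_gale e m).
Proof. exact: mixture_gale (@accepts_size e m) (@accepts_count_decode e m). Qed.

Lemma accepted_gale_ge e m w : accepted e m w ->
  (sigma R m / tau R m) ^+ size w <= accepted_gale e m w.
Proof.
move=> [u [au uw]].
have := mixture_accepted R (@accepts_size e m) (@accepts_count_decode e m) au.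
by rewrite uw codeK.
Qed.

Lemma accepted_gale_lower_semicomputable e m :
  lower_semicomputable (accepted_gale e m).
Proof.
pose comp c x := if (clen c < clen x)%N then cprefix c x else cprefix x c.
have ccomp : computable 2 (fun xs => comp (nth 0%N xs 0) (nth 0%N xs 1)).
  apply: (computable_ext (F := fun xs => if (clen (nth 0%N xs 0) < clen (nth 0%N xs 1))%N
      then cprefix (nth 0%N xs 0) (nth 0%N xs 1) : nat
      else cprefix (nth 0%N xs 1) (nth 0%N xs 0))); last by computability.
  by move=> xs; rewrite /comp; case: ifP.
pose den t c := (m.+2 ^ clen c * m.*2.+2 ^ t * 2 ^ clen c)%N.
pose num t c := nsum t (fun u => (accepts e m u && comp c (pr1 u)) *
    (m.*2.+3 ^ clen c * (m.+2 ^ clen (pr1 u) * m.*2.+2 ^ (t - clen (pr1 u))) *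
     2 ^ (clen c - (clen c - clen (pr1 u)))))%N.
apply: (@lower_semicomputableI _ (fun t c a b =>
    (a * den t c < b.+1 * num t c)%N)); first by rewrite /den /num; computability.
move=> w a b.
rewrite (mixture_ratio R (@accepts_size e m) (@accepts_count_decode e m)).
suff E t : approx_num m (accepts e m) (fun u => decode (pr1 u)) t w = num t (code w).
  by split=> -[t H]; exists t; move: H; rewrite E /den clen_code.
apply: eq_nsum => u; rewrite clen_code clen_decode.
suff -> : compatible w (decode (pr1 u)) = comp (code w) (pr1 u) by [].
by rewrite /comp -{2 3 4}(decodeK (pr1 u)) !cprefix_code !clen_code.
Qed.

Lemma Dim_lt1_accepted s d A : gale s d -> lower_semicomputable d ->
  succeeds_strongly d A -> s < 1 ->
  exists e m n0, forall n, (n0 <= n)%N -> accepted e m (mkseq A n).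
Proof.
move=> gd [f fP] sd s1; set x : R := 2 `^ s in gd.
have x1 : 1 < x := gale_growth_gt1 gd sd (powR_ge0 _ _).
have x2 : x < 2.
  have : expR (s * ln 2) < expR (1 * ln 2) :> R by rewrite ltr_expR ltr_pM2r ?ln2_gt0.
  by rewrite mul1r lnK ?posrE // /x /powR pnatr_eq0.
(* Since rho = 2 - 3/(m+2), this [m] gives x < rho. *)
pose m := Num.truncn (3 / (2 - x)).
pose rho : R := m.*2.+1%:R / m.+2%:R.
have xrho : 1 < rho / x.
  rewrite ltr_pdivlMr ?(lt_trans ltr01) // mul1r ltr_pdivlMr ?ltr0n //.
  have := truncnS_gt (3 / (2 - x) : R); rewrite -/m ltr_pdivrMr ?subr_gt0 //.
  rewrite -addnn -addSn natrD -[m.+2%:R]natr1 -[m.+1%:R]natr1; move: (m%:R : R) => y; nra.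
(* Beyond [n1] the bound x^n d(empty) is below rho^n; beyond [n2] the gale exceeds 1 along [A]. *)
have [n1 n1P] := expr_unbounded (d [::]) xrho.
have [n2 n2P] := (succeeds_stronglyP d A).1 sd 1.
exists (enc f), m, (maxn n1 n2) => n; rewrite geq_max => /andP [/n1P dn /n2P].
set w := mkseq A n => dw; have wn : size w = n by rewrite size_mkseq.
have [t ht] : exists t, halting (enc f) (code w) t.
  (* The arguments 1 and 0 encode the rational 1 / (0 + 1), so halting means that the gale exceeds
     1. *)
  by apply/kleene_normal_form/fP; rewrite divr1.
have [u eu uw] := (enumerates_halting _ _).1 (ex_intro _ t ht).
exists u; split=> //; rewrite /accepts eu uw clen_code wn /=.
pose b i := enumerates (enc f) i && (clen (pr1 i) == n).
(* The distinct strings of length n enumerated up to and including stage [u]; [d] exceeds 1 on each,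
   so their number is at most x^n d(empty). *)
pose l := [seq decode (pr1 i) | i <- iota 0 u.+1 & b i].
have sl : (enum_count (enc f) n u).+1 = size l.
  rewrite size_map size_filter -[in RHS](addn1 u) iotaD count_cat -enum_countE /= add0n.
  by rewrite /b eu uw clen_code wn eqxx addn0 addn1.
have ul : uniq l.
  rewrite map_inj_in_uniq ?filter_uniq ?iota_uniq // => i j.
  rewrite !mem_filter => /andP [/andP [ei _] _] /andP [/andP [ej _] _].
  by move=> /(congr1 code); rewrite !decodeK; exact: enumerates_pr1_inj ei ej.
have ln : forall v, v \in l -> size v = n.
  move=> v /mapP [i]; rewrite mem_filter => /andP [/andP [_ /eqP <-] _] ->.
  by rewrite -clen_decode.
rewrite sl -(ler_nat R) natrM !natrX -ler_pdivlMr ?exprn_gt0 ?ltr0n // -expr_div_n -/rho.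
have le1 : (size l)%:R <= \sum_(v <- l) d v.
  rewrite -sum1_size natr_sum big_seq [leRHS]big_seq; apply: ler_sum => v.
  move=> /mapP [i]; rewrite mem_filter => /andP [/andP [ei _] _] ->.
  have : halts f [:: code (decode (pr1 i)); 1; 0]%N.
    apply/kleene_normal_form; rewrite decodeK.
    by apply/(enumerates_halting (enc f) (pr1 i)); exists i.
  by move=> /fP; rewrite divr1 => /ltW.
apply: le_trans le1 _; apply: le_trans (gale_uniq_sum gd ul ln) _.
move: dn; rewrite expr_div_n ltr_pdivlMr ?exprn_gt0 ?(lt_trans ltr01) //.
by rewrite mulrC => /ltW.
Qed.

Lemma Dim_eq1_acceptedP A : Dim R A = 1 <->
  forall e m n0, exists n, (n0 <= n)%N /\ ~ accepted e m (mkseq A n).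
Proof.
rewrite Dim_eq1P; split=> [H e m n0|H s d gd ld sd].
  apply: contrapT => none; suff : 1 <= lg (sigma R m).
    by rewrite leNgt lg_lt1 // sigma_gt0 sigma_lt2.
  apply: (H _ (accepted_gale e m)).
  - by apply: gale_lg; [exact: sigma_gt0 | exact: accepted_gale_gale].
  - exact: accepted_gale_lower_semicomputable.
  - apply/succeeds_stronglyP => c.
    have [n1 n1P] := expr_unbounded c (sigma_tau_gt1 R m).
    exists (maxn n0 n1) => n; rewrite geq_max => /andP [le0 /n1P cn].
    apply: lt_le_trans cn _; rewrite -[X in _ ^+ X](size_mkseq A n).
    apply: accepted_gale_ge; apply: contrapT => na; apply: none.
    by exists n.
rewrite leNgt; apply/negP => s1.
have [e [m [n0 accP]]] := Dim_lt1_accepted gd ld sd s1.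
by have [n [/accP]] := H e m n0.
Qed.

(** The gale of the test is at least 1 on accepted strings, so an extension where it drops below 1
    is rejected. *)
Lemma not_accepted_extension e m n0 w :
  exists v, [/\ prefix w v, (n0 <= size v)%N & ~ accepted e m v].
Proof.
have sg : 0 <= sigma R m < 2 by rewrite ltW ?sigma_gt0 //= sigma_lt2.
have [v [wv nv dv]] := gale_small_extension (accepted_gale_gale e m) w n0 sg ltr01.
exists v; split=> // /accepted_gale_ge; apply/negP; rewrite -ltNge.
by apply: lt_le_trans dv _; rewrite exprn_ege1 // ltW // sigma_tau_gt1.
Qed.

Lemma Pi02_Pi01_DIM1str : Pi02_Pi01 (DIM1str R).
Proof.
(* The index [k] codes the triple of [e], [m] and [n0]. *)
pose P k w := (pr2 (pr2 k) <= size w)%N /\ ~ accepted (pr1 k) (pr1 (pr2 k)) w.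
exists P; split.
  (* The complement is c.e.: either [w] is too short, which is decidable, or some stage [u] accepts
     it. *)
  have [|f fP] := @halts_bool 2 (fun u xs => (clen (nth 0%N xs 1) < pr2 (pr2 (nth 0%N xs 0)))%N ||
      (accepts (pr1 (nth 0%N xs 0)) (pr1 (pr2 (nth 0%N xs 0))) u && (pr1 u == nth 0%N xs 1))).
    by computability.
  exists f => k w; rewrite fP //= clen_code.
  split=> [nP|[u /orP [lt|/andP [au /eqP uw]]] [le na]].
  - case: ltnP => le; first by exists 0%N.
    have [u [au uw]] : accepted (pr1 k) (pr1 (pr2 k)) w.
      by apply: contrapT => na; apply: nP.
    by exists u; rewrite /= au uw eqxx.
  - by move: lt; rewrite ltnNge le.
  - by apply: na; exists u.
move=> A; rewrite /DIM1str /= Dim_eq1_acceptedP; split=> [H k|H e m n0].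
  have [n [le na]] := H (pr1 k) (pr1 (pr2 k)) (pr2 (pr2 k)).
  by exists n; split=> //; rewrite size_mkseq.
have [n []] := H (pr e (pr m n0)); rewrite !(pr1K, pr2K) size_mkseq => le na.
by exists n.
Qed.
End Dimension.

(** * Effective Baire category *)

Lemma increasing_limit (W : nat -> seq bool) :
  (forall k, prefix (W k) (W k.+1)) -> (forall k, (k <= size (W k))%N) ->
  exists A : nat -> bool, forall n k, (n <= size (W k))%N -> mkseq A n = take n (W k).
Proof.
move=> pW sW; have pWD k j : prefix (W k) (W (k + j)%N).
  elim: j => [|j IH]; first by rewrite addn0 prefix_refl.
  by rewrite addnS; apply: prefix_trans IH (pW _).
have nthW i j k : (i < size (W j))%N -> (i < size (W k))%N ->
    nth false (W j) i = nth false (W k) i.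
  wlog le : j k / (j <= k)%N => [H|].
    by case: (leqP j k) => [|/ltnW] le ij ik; [exact: H | rewrite (H k j)].
  move=> ij _; have := pWD j (k - j)%N; rewrite subnKC // => /prefixP [u ->].
  by rewrite nth_cat ij.
(* [W n.+1] has more than n bits, so this bit is never the default value. *)
exists (fun n => nth false (W n.+1) n) => n k nk.
apply: (@eq_from_nth _ false); rewrite size_mkseq ?size_takel // => i ilt.
rewrite nth_mkseq // nth_take //; apply: nthW; first exact: sW.
exact: leq_trans nk.
Qed.

Section NotPi02.
Variable R : realType.

(** Starting from [w], stage k extends the current string to one rejected by the test coded by k;
    the limit meets every requirement. *)
Lemma Dim_eq1_dense w : exists A, Dim R A = 1 /\ mkseq A (size w) = w.
Proof.
have step (p : nat * seq bool) : exists v, [/\ prefix p.2 v, (size p.2 < size v)%N,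
    (pr2 (pr2 p.1) <= size v)%N & ~ accepted (pr1 p.1) (pr1 (pr2 p.1)) v].
  have [v [? le ?]] := not_accepted_extension R (pr1 p.1) (pr1 (pr2 p.1))
    (maxn (size p.2).+1 (pr2 (pr2 p.1))) p.2.
  by exists v; move: le; rewrite geq_max => /andP [? ?].
have [next nextP] := choice step.
pose W k := nat_rect (fun=> seq bool) w (fun k v => next (k, v)) k.
have WS k : W k.+1 = next (k, W k) by [].
have [|k|A AP] := @increasing_limit W.
- by move=> k; rewrite WS; have [] := nextP (k, W k).
- elim: k => // k IH; rewrite WS; have [_ lt _ _] := nextP (k, W k).
  exact: leq_ltn_trans lt.
exists A; split; last by rewrite (AP _ 0%N) // take_size.
apply/Dim_eq1_acceptedP => e m n0; pose k := pr e (pr m n0).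
exists (size (W k.+1)); rewrite (AP _ k.+1) // take_size WS.
by have [_ _] := nextP (k, W k); rewrite /= !(pr1K, pr2K).
Qed.

(** The gale of growth 3/2 that stakes everything on [A] is computable and equals (3/2)^n on the
    prefixes of [A]. *)
Lemma computable_Dim_neq1 (A : nat -> bool) (C : nat -> bool) :
  computable 1 (fun xs => C (nth 0%N xs 0)) ->
  (forall w, C (code w) = (mkseq A (size w) == w)) -> Dim R A <> 1.
Proof.
move=> cC CA /Dim_eq1P H; suff : 1 <= lg (3 / 2 : R) by rewrite leNgt lg_lt1 //; lra.
apply: (H _ (fun w => (3 / 2) ^+ size w * (C (code w))%:R)).
- apply: gale_lg; first by lra.
  split=> w; first by rewrite mulr_ge0 // exprn_ge0 //; lra.
  rewrite !CA !size_rcons exprS mkseqS !eqseq_rcons.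
  by case: (mkseq A (size w) == w); case: (A (size w)) => /=; ring.
- exact: (power_lower_semicomputable R 2 1 cC).
- apply/succeeds_stronglyP => c.
  have [|n0 n0P] := @expr_unbounded R (3 / 2) c; first by lra.
  by exists n0 => n /n0P; rewrite CA size_mkseq eqxx mulr1.
Qed.

(* Always take the first extension that enters the next open set. *)
Lemma decidable_dense_computable (P : nat -> seq bool -> Prop) :
  decidable_pred P ->
  (forall k w, exists u a, prefix a (w ++ u) /\ P k a) ->
  exists (A : nat -> bool) (C : nat -> bool),
    [/\ computable 1 (fun xs => C (nth 0%N xs 0)),
        forall w, C (code w) = (mkseq A (size w) == w)
      & forall k, exists m, P k (mkseq A m)].
Proof.
move=> [f fP] dense; pose b k c : bool := `[< P k (decode c) >].
have cb : computable 2 (fun xs => b (nth 0%N xs 0) (nth 0%N xs 1)).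
  exists f => -[|k [|c []]] // _ /=; rewrite -{1}(decodeK c) /b.
  by case: asboolP => [/(fP _ _).1|/(fP _ _).2].
(* A prefix has a code no larger than that of the whole string, so the search for it is bounded. *)
pose good k c u := bex (ccat c u).+1 (fun a => cprefix a (ccat c u) && b k a).
have [||G cG GP] := @computable_choice 2 (fun u xs => good (nth 0%N xs 0) (nth 0%N xs 1) u).
- by rewrite /good; computability.
- move=> xs _; move: (nth 0%N xs 0) (nth 0%N xs 1) => k c.
  have [u [a [au Pa]]] := dense k (decode c).
  exists (code u); apply/bexP; exists (code a).
    rewrite -{1}(decodeK c) ccat_code ltnS; case/prefixP: au => z ->.
    by rewrite code_cat leq_addr.
  rewrite -{1}(decodeK c) ccat_code cprefix_code au /b codeK.
  exact/asboolP.
pose g k c := G [:: k; c].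
have cg : computable 2 (fun xs => g (nth 0%N xs 0) (nth 0%N xs 1)).
  by apply: computable_ext_in cG => -[|k [|c []]].
(* The number 1 codes the string of the single bit [false], appended so that every stage lengthens
   the string. *)
pose c k := nat_rect (fun=> nat) 0%N (fun k c => ccat (ccat c (g k c)) 1) k.
have cc : computable 1 (fun xs => c (nth 0%N xs 0)).
  rewrite /c; apply: (computable_rec (G := fun=> 0%N)
    (S := fun k c _ => ccat (ccat c (g k c)) 1)); computability.
pose W k := decode (c k).
have WS k : W k.+1 = W k ++ decode (g k (c k)) ++ [:: false].
  apply: code_inj; rewrite decodeK /= -/(c k) -{1}(decodeK (c k)).
  by rewrite -{1}(decodeK (g k (c k))) ccat_code -[1%N]/(code [:: false]) ccat_code catA.
have sW k : (k <= size (W k))%N.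
  by elim: k => // k IH; rewrite WS !size_cat /=; lia.
have [|//|A AP] := @increasing_limit W; first by move=> k; rewrite WS prefix_prefix.
(* [W] at stage [size w] has at least [size w] bits, so it decides whether [w] is a prefix of
   [A]. *)
exists A, (fun x => cprefix x (c (clen x))); split; first by computability.
  move=> w; rewrite clen_code -{1}(decodeK (c _)) cprefix_code prefixE.
  by rewrite (AP _ (size w)).
move=> k; have /bexP [a _ /andP [pa /asboolP Pa]] := GP [:: k; c k] erefl.
exists (size (decode a)); suff : prefix (decode a) (W k.+1).
  move=> pW; rewrite (AP _ k.+1); last by case/prefixP: pW => z ->;
    rewrite size_cat leq_addr.
  by move: pW; rewrite prefixE => /eqP ->.
apply: prefix_trans (_ : prefix (W k ++ decode (g k (c k))) _); last first.
  by rewrite WS catA prefix_prefix.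
move: pa; rewrite /= -/(g k (c k)) -{1}(decodeK a) -{1}(decodeK (c k)).
by rewrite -{1}(decodeK (g k (c k))) ccat_code cprefix_code.
Qed.

Lemma not_Pi02_DIM1str : ~ Pi02 (DIM1str R).
Proof.
move=> [P [dP XP]].
have [k w|A [C [cC CA PA]]] := decidable_dense_computable dP.
  have [A [dA Aw]] := Dim_eq1_dense w; have [m Pm] := (XP A).1 dA k.
  (* The prefix satisfying [P k] may be shorter than [w]; continuing [w] along [A] by [m] bits
     covers both. *)
  exists (mkseq (fun i => A (size w + i)%N) m), (mkseq A m); split=> //.
  have -> : w ++ mkseq (fun i => A (size w + i)%N) m = mkseq A (size w + m).
    rewrite -{1}Aw /mkseq iotaD map_cat add0n; congr (_ ++ _).
    by rewrite -[in RHS](addn0 (size w)) iotaDl -map_comp.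
  by rewrite addnC /mkseq iotaD map_cat prefix_prefix.
exact: (computable_Dim_neq1 cC CA ((XP A).2 PA)).
Qed.
End NotPi02.

Theorem mainTheorem14 (R : realType) :
  ~ Pi02 (DIM1str R) /\ (Pi02_Pi01 (DIM1str R) /\ ~ Pi02 (DIM1str R)).
Proof.
split; first exact: not_Pi02_DIM1str.
by split; [exact: Pi02_Pi01_DIM1str | exact: not_Pi02_DIM1str].
Qed.
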